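(* Let $L$ be a minimal Q-graded subalgebra of a finite dimensional semisimple Lie algebra $\mathbb{L}$ over $\mathbb{F}$ with $\dim L = 2\dim [L,L]$, and let $\bar L$ be its twisted loop algebra. Then the derivation algebra of $\bar L$ has the decomposition (direct sum of vector spaces) $$\mathrm{Der}(\bar L)=\mathrm{Der}(L)_{\bar 0}\otimes R\;\oplus\; \mathrm{Der}(L)_{\bar 1}\otimes Rt\;\oplus\; \mathrm{Cent}(L)\otimes \mathrm{Der}(S),$$ where an element $d\in \mathrm{Der}(S)$ is identified with a linear map $\delta: R\to R$ such that $$\delta(t^{2j})=j\,t^{2j-2}f(t)\quad\text{for all } j\in\mathbb{Z},$$ with $f(t)\in R$ a Laurent polynomial depending only on $d$. Moreover, any homogeneous almost inner derivation of the Lie algebra $\bar L$ is an inner derivation.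
   Context: $\mathbb{F}$ is an algebraically closed field of characteristic $0$, $\mathbb{L}$ is a finite dimensional semisimple Lie algebra over $\mathbb{F}$, $H$ is a maximal torus of $\mathbb{L}$, $\Phi$ is the corresponding root system with a base $\{\alpha_1,\dots,\alpha_l\}$, $\mathbb{L}=H\oplus\bigoplus_{\alpha\in\Phi}L_\alpha$ is the root space decomposition, and $Q=\mathbb{Z}\Phi$ is the root lattice. Minimal Q-graded subalgebra: a subalgebra $L$ of $\mathbb{L}$ such that (1) $H\subseteq L$ and there is a subset $\Psi\subseteq\Phi$ with $\mathrm{span}_{\mathbb{Z}}\Psi=Q$ and $L=H\oplus\bigoplus_{\alpha\in\Psi}L_\alpha$; (2) no subalgebra $L_1\subsetneq L$ satisfies (1). Put $I=[L,L]$. When $\dim L=2\dim[L,L]$ one has $L=H\oplus I$, and $L$ is $\mathbb{Z}_2$-graded with $L_{\bar 0}=H$, $L_{\bar 1}=I$. For a $\mathbb{Z}_2$-graded Lie algebra $\mathcal{L}$ and $k\in\mathbb{Z}_2$, $\mathrm{Der}(\mathcal{L})_{k}=\{D\in\mathrm{Der}(\mathcal{L}) : D(\mathcal{L}_i)\subseteq\mathcal{L}_{i+k},\ i=\bar 0,\bar 1\}$; elements of $\mathrm{Der}(\mathcal L)_{\bar 0}$ are called even, of $\mathrm{Der}(\mathcal L)_{\bar 1}$ odd, and even or odd derivations are called homogeneous. $S=\mathbb{F}[t,t^{-1}]$ and $R=\mathbb{F}[t^2,t^{-2}]$. The twisted loop algebra is $\bar L=H\otimes R\oplus I\otimes Rt$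 with bracket $[a\otimes f,b\otimes g]=[a,b]\otimes fg$ (a subalgebra of $L\otimes S$); it is $\mathbb{Z}_2$-graded by $\bar L_{\bar 0}=H\otimes R$, $\bar L_{\bar 1}=I\otimes Rt$. $\mathrm{Cent}(L)$ is the centroid of $L$: the linear maps $\lambda:L\to L$ with $\lambda([x,y])=[\lambda(x),y]=[x,\lambda(y)]$ for all $x,y\in L$. The summands act on $\bar L$ as follows. For $d\in\mathrm{Der}(L)_{\bar 0},\ r\in R$ (respectively $d\in \mathrm{Der}(L)_{\bar 1}$, $r\in Rt$): $(d\otimes r)(a\otimes f)=d(a)\otimes rf$. For $\lambda\in\mathrm{Cent}(L)$ and $\delta$ as in the claim: $(\lambda\otimes\delta)(h\otimes s)=\lambda(h)\otimes\delta(s)$ and $(\lambda\otimes\delta)(x\otimes st)=\lambda(x)\otimes\delta(s)t$ for $h\in H$, $x\in I$, $s\in R$. Via the stated identification, $\mathrm{Der}(S)$ stands for the space of all maps $\delta:R\to R$ of the displayed form, with $f\in R$ arbitrary. A derivation $D$ of a Lie algebra $\mathcal{L}$ is almost inner if $D(x)\in[x,\mathcal{L}]$ for every $x\in\mathcal{L}$. *)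

(* Defs.v *)
From HB Require Import structures.
From mathcomp Require Import all_boot all_order all_algebra.
From mathcomp Require Import finmap boolp functions monalg.

Set Implicit Arguments.
Unset Strict Implicit.
Unset Printing Implicit Defensive.
Import GRing.Theory.
Local Open Scope ring_scope.

Section LieAlgebra.
Variables (F : fieldType) (V : lmodType F) (br : V -> V -> V).

Record lie_bracket : Prop := LieBracket {
  lie_linearl : forall y, linear (br^~ y);
  lie_linearr : forall x, linear (br x);
  lie_alternating : forall x, br x x = 0;
  lie_jacobi : forall x y z, br x (br y z) + br y (br z x) + br z (br x y) = 0
}.

Section BracketTheory.
Hypothesis lieV : lie_bracket.

Lemma lie_suml I (r : seq I) (c : I -> F) (v : I -> V) y :
  br (\sum_(i <- r) c i *: v i) y = \sum_(i <- r) c i *: br (v i) y.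
Proof.
pose f : {linear V -> V} := HB.pack (br^~ y)
  (GRing.isLinear.Build _ _ _ _ (br^~ y) (lie_linearl lieV y)).
rewrite -[LHS]/(f _) linear_sum.
by apply: eq_bigr => i _; rewrite linearZ.
Qed.

Lemma lie_sumr I (r : seq I) (c : I -> F) (v : I -> V) x :
  br x (\sum_(i <- r) c i *: v i) = \sum_(i <- r) c i *: br x (v i).
Proof.
pose f : {linear V -> V} := HB.pack (br x)
  (GRing.isLinear.Build _ _ _ _ (br x) (lie_linearr lieV x)).
rewrite -[LHS]/(f _) linear_sum.
by apply: eq_bigr => i _; rewrite linearZ.
Qed.

End BracketTheory.

Definition derivation (D : V -> V) : Prop :=
  linear D /\ forall x y, D (br x y) = br (D x) y + br x (D y).

Definition centroid (f : V -> V) : Prop :=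
  linear f /\ forall x y, f (br x y) = br (f x) y /\ f (br x y) = br x (f y).

Definition inner (D : V -> V) : Prop := exists a, forall x, D x = br a x.

Definition almost_inner (D : V -> V) : Prop :=
  derivation D /\ forall x, exists y, D x = br x y.

(* Z/2 is [bool] with addition [(+)]; [gr i] is the component of       *)
(* degree i.                                                           *)
Definition graded_derivation (gr : bool -> {pred V}) (k : bool) (D : V -> V) :
  Prop :=
  derivation D /\ forall i x, x \in gr i -> D x \in gr (i (+) k).

Definition homogeneous_derivation (gr : bool -> {pred V}) (D : V -> V) : Prop :=
  exists k, graded_derivation gr k D.

End LieAlgebra.

Section FiniteDim.
Variables (F : fieldType) (V : vectType F) (br : V -> V -> V).
Implicit Types U W : {vspace V}.

Definition lie_comm U W : {vspace V} :=
  <<[seq br u w | u <- vbasis U, w <- vbasis W]>>%VS.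

Lemma lie_comm_in U W (lieV : lie_bracket br) u w :
  u \in U -> w \in W -> br u w \in lie_comm U W.
Proof.
move=> uU wW; rewrite (coord_vbasis uU) (coord_vbasis wW).
rewrite lie_suml // rpred_sum // => i _; rewrite rpredZ //.
rewrite lie_sumr // rpred_sum // => j _; rewrite rpredZ //.
by apply/memv_span/allpairs_f; rewrite mem_nth ?size_tuple.
Qed.

Definition subalgebra U : Prop := forall x y, x \in U -> y \in U -> br x y \in U.

Definition ideal U : Prop := forall x y, y \in U -> br x y \in U.

Definition solvable U : Prop := exists n, iter n (fun W => lie_comm W W) U = 0%VS.

Definition semisimple : Prop := forall U, ideal U -> solvable U -> U = 0%VS.

Definition diagonalizable (f : V -> V) : Prop :=
  exists e : seq V, basis_of fullv e /\
    forall v, v \in e -> exists a : F, f v = a *: v.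

(* Over an algebraically closed field a semisimple endomorphism is a   *)
(* diagonalizable one.  Toral subalgebras are automatically abelian.   *)
Definition torus U : Prop :=
  subalgebra U /\ forall x, x \in U -> diagonalizable (br x).

Definition maximal_torus U : Prop :=
  torus U /\ forall U', torus U' -> (U <= U')%VS -> U' = U.

Section Roots.
Variable H : {vspace V}.

Definition weight := 'Hom(subvs_of H, F^o).

Definition root_space (a : weight) : {vspace V} :=
  (\bigcap_(h <- vbasis {:subvs_of H})
     passmx.leigenspace (linfun (br (vsval h))) (a h))%VS.

Lemma mem_root_space (lieV : lie_bracket br) (a : weight) x :
  reflect (forall h : subvs_of H, br (vsval h) x = (a h : F) *: x)
          (x \in root_space a).
Proof.
pose f y : {linear V -> V} :=
  HB.pack (br y) (GRing.isLinear.Build _ _ _ _ (br y) (lie_linearr lieV y)).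
have eigE (h : subvs_of H) :
    (x \in passmx.leigenspace (linfun (br (vsval h))) (a h)) =
    (br (vsval h) x == (a h : F) *: x).
  rewrite memv_ker add_lfunE opp_lfunE scale_lfunE id_lfunE subr_eq0.
  by rewrite (lfunE (f (vsval h))).
have RE : (x \in root_space a) =
    all (fun h => br (vsval h) x == (a h : F) *: x) (vbasis {:subvs_of H}).
  rewrite /root_space; elim: (tval _) => [|h s IHs] /=.
    by rewrite big_nil memvf.
  by rewrite big_cons memv_cap IHs eigE.
rewrite RE; apply: (iffP allP) => [xR h | xR h _]; last by rewrite xR.
have -> : vsval h = \sum_i coord (vbasis {:subvs_of H}) i h *:
                      vsval (vbasis {:subvs_of H})`_i.
  rewrite {1}(coord_vbasis (memvf h)) linear_sum.
  by apply: eq_bigr => i _; rewrite linearZ.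
rewrite {2}(coord_vbasis (memvf h)) linear_sum lie_suml // scaler_suml.
apply: eq_bigr => i _; rewrite linearZ -[_ *: x]scalerA; congr (_ *: _).
by apply/eqP/xR/mem_nth; rewrite size_tuple.
Qed.

Definition root (a : weight) : Prop := a != 0 /\ root_space a != 0%VS.

Definition Zspan (M : zmodType) (A : M -> Prop) (v : M) : Prop :=
  exists (n : nat) (s : n.-tuple M), (forall a, a \in s -> A a) /\ inIntSpan s v.

Definition root_lattice : weight -> Prop := Zspan root.

(* The root system is finite, so a subset of it is given by a          *)
(* duplicate-free sequence [Psi].                                      *)
Definition Q_graded U : Prop :=
  [/\ subalgebra U, (H <= U)%VS &
    exists Psi : seq weight,
      [/\ uniq Psi, forall a, a \in Psi -> root a,
          forall v, Zspan (fun a => a \in Psi) v <-> root_lattice v,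
          directv (H + \sum_(a <- Psi) root_space a) &
          U = (H + \sum_(a <- Psi) root_space a)%VS]].

Definition minimal_Q_graded U : Prop :=
  Q_graded U /\ forall U', Q_graded U' -> (U' <= U)%VS -> U' = U.

End Roots.

(* [sub_br U] is the bracket of the subalgebra U, see [sub_brE]; the   *)
(* default value of [vsproj] is used only if U is not a subalgebra.    *)
Definition sub_br U (x y : subvs_of U) : subvs_of U :=
  vsproj U (br (vsval x) (vsval y)).

Definition subv_in U W : {vspace subvs_of U} :=
  (linfun (vsval : subvs_of U -> V) @^-1: W)%VS.

Lemma sub_brE U (x y : subvs_of U) :
  subalgebra U -> vsval (sub_br x y) = br (vsval x) (vsval y).
Proof. by move=> algU; rewrite vsprojK ?algU ?subvsP. Qed.

Lemma mem_subv_in U W x : (x \in subv_in U W) = (vsval x \in W).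
Proof. by rewrite -memv_preim lfunE. Qed.

End FiniteDim.

(* [laurent V] is V (x) F[t, t^-1]: finitely supported families of     *)
(* coefficients; [<< a *g k >>] is a (x) t^k and [u@_k] the            *)
(* coefficient of t^k in u.  In particular F[t, t^-1] is               *)
(* [laurent F^o].                                                      *)
Definition laurent (F : fieldType) (V : lmodType F) := {malg V[int]}.


Section Laurent.
Variables (F : fieldType) (V : lmodType F).
Implicit Types (u v : laurent V) (f g : laurent F^o).

HB.instance Definition _ := GRing.Zmodule.on (laurent V).

Definition lscale (c : F) u : laurent V :=
  \sum_(k <- msupp u) << c *: u@_k *g k >>.

Lemma lscaleE c u k : (lscale c u)@_k = c *: u@_k.
Proof.
rewrite {2}[u]monalgE /lscale !(raddf_sum (mcoeff k)) scaler_sumr.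
by apply: eq_bigr => /= i _; rewrite !mcoeffU scalerMnr.
Qed.

Fact lscaleA c d u : lscale c (lscale d u) = lscale (c * d) u.
Proof. by apply/malgP=> k; rewrite !lscaleE scalerA. Qed.

Fact lscale1 : left_id 1 lscale.
Proof. by move=> u; apply/malgP=> k; rewrite lscaleE scale1r. Qed.

Fact lscaleDr : right_distributive lscale +%R.
Proof. by move=> c u v; apply/malgP=> k; rewrite !(mcoeffD, lscaleE) scalerDr. Qed.

Fact lscaleDl u : {morph lscale^~ u : c d / c + d}.
Proof. by move=> c d; apply/malgP=> k; rewrite !(mcoeffD, lscaleE) scalerDl. Qed.

HB.instance Definition _ := GRing.Zmodule_isLmodule.Build F (laurent V)
  lscaleA lscale1 lscaleDr lscaleDl.

Lemma lcoeffZ c u k : (c *: u)@_k = c *: u@_k.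
Proof. exact: lscaleE. Qed.

(* a (x) f *)
Definition tens (a : V) f : laurent V := \sum_(k <- msupp f) << f@_k *: a *g k >>.

Lemma tensE a f k : (tens a f)@_k = f@_k *: a.
Proof.
rewrite {2}[f]monalgE /tens !(raddf_sum (mcoeff k)) scaler_suml.
by apply: eq_bigr => /= i _; rewrite !mcoeffU scalerMnl.
Qed.

(* A family of additive maps G k defines the additive map              *)
(* a (x) t^k |-> G k a, given by the sum below; it may be computed on  *)
(* any decomposition into monomials.                                   *)
Section LinearExtension.
Variables (E : zmodType) (G : int -> V -> E).
Hypothesis GD : forall k, {morph G k : a b / a + b}.

Let G0 k : G k 0 = 0.
Proof. by apply: (@addrI _ (G k 0)); rewrite -GD !addr0. Qed.

Let ext_widen u (D : {fset int}) : (msupp u `<=` D)%fset ->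
  \sum_(k <- msupp u) G k u@_k = \sum_(k <- D) G k u@_k.
Proof.
by move=> uD; apply: big_fset_incl => // k _ /mcoeff_outdom ->; rewrite G0.
Qed.

Lemma laurent_extU a k :
  \sum_(i <- msupp (<< a *g k >> : laurent V)) G i (<< a *g k >>)@_i = G k a.
Proof. by rewrite (ext_widen msuppU_le) big_seq_fset1 mcoeffUU. Qed.

Lemma laurent_extD u v :
  \sum_(k <- msupp (u + v)) G k (u + v)@_k =
  \sum_(k <- msupp u) G k u@_k + \sum_(k <- msupp v) G k v@_k.
Proof.
rewrite (ext_widen (msuppD_le u v)) (ext_widen (fsubsetUl _ (msupp v))).
rewrite (ext_widen (fsubsetUr (msupp u) _)) -big_split.
by apply: eq_bigr => k _; rewrite mcoeffD GD.
Qed.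

Lemma laurent_ext_sum I (r : seq I) (a : I -> V) (n : I -> int) u :
    u = \sum_(i <- r) << a i *g n i >> ->
  \sum_(k <- msupp u) G k u@_k = \sum_(i <- r) G (n i) (a i).
Proof.
move->; elim: r => [|i r IHr]; first by rewrite !big_nil msupp0 big_nil.
by rewrite !big_cons laurent_extD IHr laurent_extU.
Qed.

End LinearExtension.

End Laurent.

Section Mul.
Variable (F : fieldType).
Implicit Types (f g : laurent F^o).

Definition lmul f g : laurent F^o :=
  \sum_(i <- msupp f) \sum_(j <- msupp g) << f@_i * g@_j *g i + j >>.

Definition lX (k : int) : laurent F^o := << 1 *g k >>.

Lemma lmulX f k : lmul f (lX k) = \sum_(i <- msupp f) << f@_i *g i + k >>.
Proof.
rewrite /lmul; apply: eq_bigr => i _; rewrite msuppU oner_eq0 big_seq_fset1.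
by rewrite mcoeffUU mulr1.
Qed.

Lemma lmulXE f k m : (lmul f (lX k))@_m = f@_(m - k).
Proof.
rewrite lmulX [in RHS](monalgE f) !(raddf_sum (mcoeff _)).
by apply: eq_bigr => /= i _; rewrite !mcoeffU [i == _]eq_sym subr_eq eq_sym.
Qed.

Lemma lmul_sumr f g : lmul f g = \sum_(k <- msupp g) g@_k *: lmul f (lX k).
Proof.
rewrite /lmul exchange_big; apply: eq_bigr => k _; rewrite -/(lmul f _) lmulX.
rewrite scaler_sumr; apply: eq_bigr => i _.
by apply/malgP => m; rewrite lcoeffZ !mcoeffU -scalerMnr mulrC.
Qed.

End Mul.

(* The bracket of V (x) F[t, t^-1], i.e. the bilinear extension of     *)
(* [a (x) t^i, b (x) t^j] = [a, b] (x) t^(i + j).                      *)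
Definition laurent_br (F : fieldType) (V : lmodType F) (br : V -> V -> V)
    (u v : laurent V) : laurent V :=
  \sum_(i <- msupp u) \sum_(j <- msupp v) << br u@_i v@_j *g i + j >>.

(* A0 (x) R + A1 (x) Rt with R = F[t^2, t^-2], as a subspace of        *)
(* V (x) F[t, t^-1].                                                   *)
Section Twisted.
Variables (F : fieldType) (V : vectType F) (A0 A1 : {vspace V}).

Definition twisted : {pred laurent V} := fun u =>
  all (fun k => u@_k \in if (2 %| k)%Z then A0 else A1) (msupp u).

Lemma twistedP (u : laurent V) :
  reflect (forall k, u@_k \in if (2 %| k)%Z then A0 else A1) (u \in twisted).
Proof.
apply: (iffP allP) => [uA k | uA k _]; last exact: uA.
have [/uA //|/mcoeff_outdom ->] := boolP (k \in msupp u).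
by case: ifP => _; exact: mem0v.
Qed.

Fact twisted_submod : submod_closed twisted.
Proof.
split=> [|c u v /twistedP uA /twistedP vA]; apply/twistedP => k.
  by rewrite mcoeff0; case: ifP => _; exact: mem0v.
by rewrite mcoeffD lcoeffZ memvD ?memvZ.
Qed.

HB.instance Definition _ :=
  GRing.isSubmodClosed.Build F (laurent V) twisted twisted_submod.

Record twloop := TwLoop { twval : laurent V; _ : twval \in twisted }.

HB.instance Definition _ := [isSub for twval].
HB.instance Definition _ := [Choice of twloop by <:].
HB.instance Definition _ := [SubChoice_isSubLmodule of twloop by <:].

End Twisted.

Arguments twval {F V A0 A1}.

Section TwistedLoopAlgebra.
Variables (F : fieldType) (V : vectType F) (br : V -> V -> V).
Variables (A0 A1 : {vspace V}).

(* If V = A0 + A1 is a Z/2-graded Lie algebra, then [twloop A0 A1] is  *)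
(* closed under [laurent_br br] and the default value is never used    *)
(* (see [loop_brE]).                                                   *)
Definition loop_br (x y : twloop A0 A1) : twloop A0 A1 :=
  insubd (0 : twloop A0 A1) (laurent_br br (twval x) (twval y)).

Lemma loop_brE x y :
    {in A0 & A0, forall a b, br a b \in A0} ->
    {in A0 & A1, forall a b, br a b \in A1} ->
    {in A1 & A0, forall a b, br a b \in A1} ->
    {in A1 & A1, forall a b, br a b \in A0} ->
  twval (loop_br x y) = laurent_br br (twval x) (twval y).
Proof.
move=> h00 h01 h10 h11; apply: insubdK; rewrite /laurent_br.
apply: rpred_sum => i _; apply: rpred_sum => j _; apply/twistedP => k.
rewrite mcoeffU; have [<-{k}|_] := eqVneq; last by case: ifP; rewrite mem0v.
have /twistedP/(_ i) := valP x; have /twistedP/(_ j) := valP y.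
have [i2|i2] := boolP (2 %| i)%Z; have [j2|j2] := boolP (2 %| j)%Z => yj xi.
- by rewrite rpredD //; exact: h00.
- by rewrite rpredDl // (negPf j2); exact: h01.
- by rewrite rpredDr // (negPf i2); exact: h10.
suff -> : (2 %| i + j)%Z by exact: h11.
have dvd2 m : (2 %| m)%Z = ((m %% 2)%Z == 0) by apply/dvdz_mod0P/eqP.
move: i2 j2; rewrite !dvd2 -modzDm.
have mod2 m : (m %% 2)%Z = 0 \/ (m %% 2)%Z = 1.
  have := modz_ge0 m (isT : (2 : int) != 0).
  have := ltz_pmod m (isT : 0 < (2 : int)).
  by case: (m %% 2)%Z => [[|[|n]]|n] //; [left | right].
by have [->|->] := mod2 i; have [->|->] := mod2 j.
Qed.

Definition lie_gr (i : bool) : {pred V} := fun x => x \in if i then A1 else A0.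

Definition loop_gr (i : bool) : {pred twloop A0 A1} :=
  fun x => twval x \in if i then twisted 0 A1 else twisted A0 0.

End TwistedLoopAlgebra.

Arguments loop_br {F V} br {A0 A1}.
Arguments loop_gr {F V} A0 A1 i.

(* The vector space R = F[t^2, t^-2]. *)
Notation evenLaurent F := (twloop (fullv : {vspace F^o}) (0%VS : {vspace F^o})).

Section Actions.
Variable (F : fieldType).

Definition in_R : {pred laurent F^o} := twisted fullv 0.
Definition in_Rt : {pred laurent F^o} := twisted 0 fullv.

Fact lX2_in_R (j : int) : lX F (2 * j) \in in_R.
Proof.
apply/twistedP => k; rewrite mcoeffU.
have [<-|_] := eqVneq; last by case: ifP => _; exact: mem0v.
by rewrite dvdz_mulr // memvf.
Qed.

(* t^(2j) *)
Definition lX2 (j : int) : evenLaurent F := TwLoop (lX2_in_R j).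

(* Der(S), identified with a space of linear maps R -> R. *)
Definition Der_S (delta : evenLaurent F -> evenLaurent F) : Prop :=
  linear delta /\
  exists f : evenLaurent F, forall j : int,
    twval (delta (lX2 j)) = (j%:~R : F) *: lmul (lX F (2 * j - 2)) (twval f).

Variable V : vectType F.

(* The linear extensions to V (x) F[t, t^-1] of                        *)
(*   (d (x) r)(a (x) f) = d(a) (x) r f                                 *)
(* and of                                                              *)
(*   (lam (x) delta)(a (x) s t^e) = lam(a) (x) delta(s) t^e            *)
(* for s in R and e = 0, 1.                                            *)
Definition der_act (d : 'End(V)) (r : laurent F^o) (u : laurent V) : laurent V :=
  \sum_(k <- msupp u) tens (d u@_k) (lmul r (lX F k)).

Lemma der_actE d r (a : V) f : der_act d r (tens a f) = tens (d a) (lmul r f).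
Proof.
have GD k : {morph (fun c : V => tens (d c) (lmul r (lX F k))) : c c' / c + c'}.
  by move=> c c'; apply/malgP => m; rewrite mcoeffD !tensE linearD scalerDr.
rewrite /der_act (laurent_ext_sum GD (erefl _)); apply/malgP => m.
rewrite tensE lmul_sumr !(raddf_sum (mcoeff m)) scaler_suml.
apply: eq_bigr => /= k _.
by rewrite tensE lcoeffZ linearZ /= !scalerA mulrC.
Qed.

Definition cent_act (lam : 'End(V)) (delta : evenLaurent F -> evenLaurent F)
    (u : laurent V) : laurent V :=
  \sum_(k <- msupp u)
    tens (lam u@_k) (lmul (twval (delta (lX2 (k %/ 2)%Z))) (lX F (k %% 2)%Z)).

Lemma cent_actE lam (delta : evenLaurent F -> evenLaurent F) (a : V)
    (s : evenLaurent F) (e : bool) :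
  linear delta ->
  cent_act lam delta (tens a (lmul (twval s) (lX F e))) =
  tens (lam a) (lmul (twval (delta s)) (lX F e)).
Proof.
move=> linD.
pose D : {linear evenLaurent F -> evenLaurent F} :=
  HB.pack delta (GRing.isLinear.Build _ _ _ _ delta linD).
pose G k (c : V) :=
  tens (lam c) (lmul (twval (delta (lX2 (k %/ 2)%Z))) (lX F (k %% 2)%Z)).
have GD k : {morph G k : c c' / c + c'}.
  by move=> c c'; apply/malgP => m; rewrite mcoeffD !tensE linearD scalerDr.
have even_s k : k \in msupp (twval s) -> k = 2 * (k %/ 2)%Z.
  move=> ks; rewrite mulrC divzK //; move: ks; rewrite -mcoeff_neq0.
  by have /twistedP/(_ k) := valP s; case: ifP => // _; rewrite memv0 => ->.
have sE : s = \sum_(k <- msupp (twval s)) ((twval s)@_k : F) *: lX2 (k %/ 2)%Z.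
  apply: val_inj; rewrite (raddf_sum (val : evenLaurent F -> laurent F^o)) /=.
  rewrite [in LHS](monalgE (twval s)); apply: eq_big_seq => k ks; rewrite /= -even_s //.
  by apply/malgP => m; rewrite lcoeffZ !mcoeffU -scalerMnr [_ *: 1]mulr1.
have uE : tens a (lmul (twval s) (lX F e)) =
    \sum_(k <- msupp (twval s)) << (twval s)@_k *: a *g k + e >>.
  apply/malgP => m; rewrite tensE lmulXE [in LHS](monalgE (twval s)).
  rewrite !(raddf_sum (mcoeff _)) scaler_suml; apply: eq_bigr => /= k _.
  by rewrite !mcoeffU scalerMnl [k == _]eq_sym subr_eq eq_sym.
have deltaE : delta s =
    \sum_(k <- msupp (twval s)) ((twval s)@_k : F) *: delta (lX2 (k %/ 2)%Z).
  rewrite [in LHS]sE -[LHS]/(D _) linear_sum.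
  by apply: eq_bigr => k _; rewrite linearZ.
rewrite /cent_act (laurent_ext_sum GD uE).
apply/malgP => m; rewrite tensE lmulXE deltaE -[twval (\sum_(k <- _) _)]/(val _).
rewrite (raddf_sum (val : evenLaurent F -> laurent F^o)).
rewrite !(raddf_sum (mcoeff _)) scaler_suml; apply: eq_big_seq => /= k ks.
have e2 : (e %/ 2)%Z = 0 /\ (e %% 2)%Z = e by case: (e).
have kE : k = (k %/ 2)%Z * 2 by rewrite mulrC; exact: even_s.
have q2 : ((k + e) %/ 2)%Z = (k %/ 2)%Z by rewrite {1}kE divzMDl // e2.1 addr0.
have m2 : ((k + e) %% 2)%Z = e by rewrite kE modzMDl e2.2.
rewrite /G q2 m2.
by rewrite tensE lmulXE lcoeffZ linearZ /= !scalerA mulrC.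
Qed.

(* The map defined by an element of the direct sum of Der(V)_0 (x) R,  *)
(* Der(V)_1 (x) Rt and Cent(V) (x) Der(S), each component being given  *)
(* by a formal sum of pure tensors (see [tensor_zero]).                *)
Definition loop_act (s0 s1 : seq ('End(V) * laurent F^o))
    (s2 : seq ('End(V) * (evenLaurent F -> evenLaurent F))) (u : laurent V) :
  laurent V :=
  \sum_(p <- s0) der_act p.1 p.2 u + \sum_(p <- s1) der_act p.1 p.2 u
  + \sum_(p <- s2) cent_act p.1 p.2 u.

End Actions.

Arguments in_R {F}.
Arguments in_Rt {F}.

(* An element of A (x) B, for subspaces A of U and B of W, is given by *)
(* a formal sum of pure tensors; such a sum is zero in A (x) B iff     *)
(* every bilinear map on A x B sends it to zero.                       *)
Section Tensor.
Variables (F : fieldType) (U W : lmodType F) (A : U -> Prop) (B : W -> Prop).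

Definition tensor_sum (s : seq (U * W)) : Prop :=
  forall p, p \in s -> A p.1 /\ B p.2.

Definition bilinear_on (Z : lmodType F) (phi : U -> W -> Z) : Prop :=
  (forall c u u' w, A u -> A u' -> B w ->
     phi (c *: u + u') w = c *: phi u w + phi u' w) /\
  (forall c u w w', A u -> B w -> B w' ->
     phi u (c *: w + w') = c *: phi u w + phi u w').

Definition tensor_zero (s : seq (U * W)) : Prop :=
  forall (Z : lmodType F) (phi : U -> W -> Z), bilinear_on phi ->
    \sum_(p <- s) phi p.1 p.2 = 0.

End Tensor.

(* Main.v *)
(* The roots in Psi separate the points of H, since an element of H killed by
   all roots is central in the semisimple algebra; so |Psi| >= dim H.  On the
   other hand [L, L] contains all root spaces of L, so dim L = 2 dim [L, L]
   forces |Psi| = dim H and one-dimensional root spaces.  With h_i in H dual to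
   Psi and e_i root vectors, ad (sum h_i) is 0 on H, 1 on the e_i and 2 on
   [e_i, e_j], so the e_i commute: L is a direct sum of copies of the
   two-dimensional algebra [h, e] = e, and its twisted loop algebra is the sum
   of the R h_i + Rt e_i.

   A derivation D of the latter preserves each summand.  Its h_i-coordinate on
   R h_i is a derivation of R, t^(2m) |-> m t^(2m-2) f_i, and the Leibniz rule
   determines the rest from g_i in R and b_i in Rt, where D(e_i t) = g_i e_i t
   and D(h_i) = b_i e_i.  The triples (f_i, g_i, b_i) are arbitrary in
   R x R x Rt, and Cent(L), Der(L)_0, Der(L)_1 have one basis element for each
   i, which gives the three summands.  If D is almost inner, then its values
   lie in the span of the Rt e_i, so f = 0 and D = ad (sum g_i h_i - b_i e_i). *)

Require Import Defs.
From HB Require Import structures.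
From mathcomp Require Import all_boot all_order all_algebra.
From mathcomp Require Import finmap boolp functions monalg.
From mathcomp Require Import zify ring.

Set Implicit Arguments.
Unset Strict Implicit.
Unset Printing Implicit Defensive.
Import GRing.Theory.
Local Open Scope ring_scope.

(** * Linear functions and elementary bracket identities *)

Section LinearFunctions.
Variables (F : fieldType) (U W : lmodType F) (f : U -> W).
Hypothesis fL : linear f.

Definition linear_of : {linear U -> W} :=
  HB.pack f (GRing.isLinear.Build _ _ _ _ f fL).

Lemma lin0 : f 0 = 0. Proof. exact: (linear0 linear_of). Qed.

Lemma linD u v : f (u + v) = f u + f v.
Proof. exact: (linearD linear_of). Qed.

Lemma linZ c u : f (c *: u) = c *: f u.
Proof. exact: (linearZ_LR linear_of). Qed.

Lemma linN u : f (- u) = - f u.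
Proof. exact: (linearN linear_of). Qed.

Lemma linMn u n : f (u *+ n) = f u *+ n.
Proof. exact: (linearMn linear_of). Qed.

Lemma lin_sum I (r : seq I) (P : pred I) (v : I -> U) :
  f (\sum_(i <- r | P i) v i) = \sum_(i <- r | P i) f (v i).
Proof. exact: (linear_sum linear_of). Qed.

End LinearFunctions.

Section LieBracketTheory.
Variables (F : fieldType) (V : lmodType F) (br : V -> V -> V).
Hypothesis lieV : lie_bracket br.

Lemma lie0r x : br x 0 = 0. Proof. exact: lin0 (lie_linearr lieV x). Qed.

Lemma lie0l y : br 0 y = 0. Proof. exact: lin0 (lie_linearl lieV y). Qed.

Lemma lieDl x y z : br (x + y) z = br x z + br y z.
Proof. exact: linD (lie_linearl lieV z) x y. Qed.

Lemma lieDr x y z : br x (y + z) = br x y + br x z.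
Proof. exact: linD (lie_linearr lieV x) y z. Qed.

Lemma lieZl c x y : br (c *: x) y = c *: br x y.
Proof. exact: linZ (lie_linearl lieV y) c x. Qed.

Lemma lieZr c x y : br x (c *: y) = c *: br x y.
Proof. exact: linZ (lie_linearr lieV x) c y. Qed.

Lemma lie_big_suml I (r : seq I) (P : pred I) (v : I -> V) y :
  br (\sum_(i <- r | P i) v i) y = \sum_(i <- r | P i) br (v i) y.
Proof. exact: (lin_sum (lie_linearl lieV y)). Qed.

Lemma lie_big_sumr I (r : seq I) (P : pred I) (v : I -> V) x :
  br x (\sum_(i <- r | P i) v i) = \sum_(i <- r | P i) br x (v i).
Proof. exact: (lin_sum (lie_linearr lieV x)). Qed.

Lemma lieC x y : br x y = - br y x.
Proof.
have := lie_alternating lieV (x + y).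
rewrite lieDl !lieDr !(lie_alternating lieV) add0r addr0 => /eqP.
by rewrite addr_eq0 => /eqP.
Qed.

Lemma lieNr x y : br x (- y) = - br x y.
Proof. by rewrite -scaleN1r lieZr scaleN1r. Qed.

Lemma lie_derivation x y z : br x (br y z) = br (br x y) z + br y (br x z).
Proof.
rewrite (lieC (br x y)) (lieC x z) lieNr -opprD.
by apply/eqP; rewrite -addr_eq0 addrA addrAC (lie_jacobi lieV).
Qed.

End LieBracketTheory.

(** * Toral subalgebras *)

Section Diagonalizable.
Variables (F : fieldType) (V : vectType F) (f : V -> V).
Hypotheses (fL : linear f) (fD : Defs.diagonalizable f).

(** In an eigenbasis the coefficient of [f (f v)] along an eigenvector of eigenvalue [a] is
    [c * a * a], which vanishes only if [c * a] does. *)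
Lemma diagonalizable_ker_sqr v : f (f v) = 0 -> f v = 0.
Proof.
have [e [eB eE]] := fD; pose t := in_tuple e.
have /choice [a aE] (i : 'I_(size e)) : exists a : F, f t`_i = a *: t`_i.
  by apply/eE/mem_nth.
have fE (c : 'I_(size e) -> F) :
    f (\sum_i c i *: t`_i) = \sum_i (c i * a i) *: t`_i.
  rewrite (lin_sum fL); apply: eq_bigr => i _.
  by rewrite (linZ fL) aE scalerA.
have tB : basis_of fullv t by [].
have tF := basis_free tB.
rewrite {1 2}(coord_basis tB (memvf v)) !fE => /(elimT freeP tF) c0.
rewrite big1 // => i _; have /eqP := c0 i.
by rewrite mulf_eq0 => /orP[/eqP->|/eqP->]; rewrite ?mulr0 scale0r.
Qed.

(** [P] plays the role of a subspace stable under [f]. The product of the factors [f - a] over a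
    list of eigenvalues of an eigenbasis is zero. Apply them to [v] one after the other: the last
    nonzero vector is an eigenvector and still satisfies [P]. *)
Lemma diagonalizable_eigenvector (P : V -> Prop) v :
    (forall a u, P u -> P (f u - a *: u)) -> P v -> v != 0 ->
  exists a w, [/\ w != 0, P w & f w = a *: w].
Proof.
move=> PD Pv v0; have [e [eB eE]] := fD.
have [s sE] : exists s : seq F, forall u, u \in e -> exists2 a, a \in s & f u = a *: u.
  elim: e {eB} eE => [|u e IHe] eE; first by exists [::].
  have [|s sE] := IHe; first by move=> w we; apply: eE; rewrite inE we orbT.
  have [|a aE] := eE u; first exact: mem_head.
  exists (a :: s) => w; rewrite inE => /orP[/eqP->|/sE[b bs bE]].
    by exists a; rewrite ?mem_head.
  by exists b; rewrite // inE bs orbT.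
pose g := foldl (fun u a => f u - a *: u).
have gL r : linear (g^~ r).
  elim: r => [|a r IHr] //= c x y; rewrite -IHr; congr (g _ _).
  by rewrite fL !scalerDr scalerN !scalerA [a * c]mulrC opprD addrACA.
(* A factor [f - b] only rescales the eigenvector [u], so the later factor [f - a] still kills
   it. *)
have g_eig r a u : a \in r -> f u = a *: u -> g u r = 0.
  elim: r u => //= b r IHr u; rewrite inE => ar fu; rewrite fu -scalerBl.
  have [<-|ab] := eqVneq a b; first by rewrite subrr scale0r (lin0 (gL r)).
  apply: IHr; last by rewrite (linZ fL) fu !scalerA mulrC.
  by move: ar; rewrite (negPf ab).
have tB : basis_of fullv (in_tuple e) by [].
have g0 u : g u s = 0.
  rewrite (coord_basis tB (memvf u)) (lin_sum (gL s)) big1 // => i _.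
  rewrite (linZ (gL s)) (_ : g _ s = 0) ?scaler0 //.
  by have [|a aS /g_eig->] := sE (in_tuple e)`_i; rewrite ?mem_nth.
have {g0 sE} gv := g0 v; elim: s v Pv v0 gv => [|a s IHs] v Pv v0 /= gv.
  by rewrite gv eqxx in v0.
have [/eqP|fv] := eqVneq (f v - a *: v) 0.
  by rewrite subr_eq0 => /eqP fv; exists a, v.
exact: IHs (PD a v Pv) fv gv.
Qed.

End Diagonalizable.

Section TorusTheory.
Variables (F : fieldType) (V : vectType F) (br : V -> V -> V) (H : {vspace V}).
Hypotheses (lieV : lie_bracket br) (torH : torus br H).

(** Otherwise [br x] has an eigenvector [w] in [[x, H]], with eigenvalue [a != 0] by
    [diagonalizable_ker_sqr]. Then [[w, x] = - a w] is killed by [br w], which is diagonalizable as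
    [w] lies in [H]; so [[w, x] = 0], a contradiction. *)
Lemma torus_abelian x y : x \in H -> y \in H -> br x y = 0.
Proof.
move=> xH yH; apply/eqP; apply: contraT => xy0.
have [algH diagH] := torH; have adL := lie_linearr lieV.
pose P w := exists2 z, z \in H & w = br x z.
have PD a u : P u -> P (br x u - a *: u).
  case=> z zH ->; exists (br x z - a *: z); first by rewrite rpredB ?rpredZ ?algH.
  by rewrite (lieDr lieV) (lieNr lieV) (lieZr lieV).
have [|a [w [w0 [z zH wz] xw]]] :=
  diagonalizable_eigenvector (adL x) (diagH x xH) PD _ xy0; first by exists y.
have wH : w \in H by rewrite wz algH.
have a0 : a != 0.
  apply: contraNneq w0 => a0; apply/eqP; rewrite wz.
  by apply: (diagonalizable_ker_sqr (adL x) (diagH x xH)); rewrite -wz xw a0 scale0r.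
suff : a *: w == 0 by rewrite scaler_eq0 (negPf a0) (negPf w0).
rewrite -xw (lieC lieV) oppr_eq0; apply/eqP.
apply: (diagonalizable_ker_sqr (adL w) (diagH w wH)).
rewrite (lieC lieV w x) xw (lieNr lieV) (lieZr lieV).
by rewrite (lie_alternating lieV) scaler0 oppr0.
Qed.

(** An eigenvector of [br h] inside the image of [br h] has nonzero eigenvalue. As [H] is abelian,
    the maps [br x] commute, so this vector can be replaced by a joint eigenvector for a basis of
    [H]. *)
Lemma torus_common_eigenvector h v : h \in H -> br h v != 0 ->
  exists a w, [/\ a != 0, w != 0, br h w = a *: w &
    forall x, x \in H -> exists c, br x w = c *: w].
Proof.
move=> hH hv; have [algH diagH] := torH; have adL := lie_linearr lieV.
have comm x y z : x \in H -> y \in H -> br x (br y z) = br y (br x z).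
  move=> xH yH; rewrite (lie_derivation lieV) (torus_abelian xH yH).
  by rewrite (lie0l lieV) add0r.
have [||a [w [w0 [z wz] hw]]] :=
  @diagonalizable_eigenvector _ _ _ (adL h) (diagH h hH)
    (fun w => exists z, w = br h z) (br h v) _ _ hv.
- move=> c _ [z ->]; exists (br h z - c *: z).
  by rewrite (lieDr lieV) (lieNr lieV) (lieZr lieV).
- by exists v.
have a0 : a != 0.
  apply: contraNneq w0 => a0; apply/eqP; rewrite wz.
  by apply: (diagonalizable_ker_sqr (adL h) (diagH h hH)); rewrite -wz hw a0 scale0r.
exists a.
(* Induction on [s]: the joint eigenvectors for [h] and [s] with the eigenvalues of [u] are
   preserved by [br x - d], so they contain an eigenvector of [br x]. *)
have eig (s : seq V) : {subset s <= H} -> exists u : V,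
    [/\ u != 0, br h u = a *: u & forall x, x \in s -> exists c, br x u = c *: u].
  elim: s => [|x s IHs] sH; first by exists w; split.
  have [|u [u0 hu uE]] := IHs; first by move=> y ys; apply: sH; rewrite inE ys orbT.
  have xH : x \in H by apply: sH; rewrite mem_head.
  pose P u' := br h u' = a *: u' /\ forall y, y \in s -> exists c, br y u' = c *: u'.
  have brD y c d u' : y \in H -> br y u' = c *: u' ->
      br y (br x u' - d *: u') = c *: (br x u' - d *: u').
    move=> yH yu; rewrite (lieDr lieV) (lieNr lieV) (lieZr lieV) comm // yu.
    by rewrite (lieZr lieV) scalerBr !scalerA [d * c]mulrC.
  have [||c [u' [u'0 [hu' uE'] xu']]] :=
    @diagonalizable_eigenvector _ _ _ (adL x) (diagH x xH) P u _ _ u0.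
  - move=> d u' [hu' uE']; split=> [|y ys]; first exact: brD.
    have [c cE] := uE' y ys; exists c; apply: brD => //.
    by apply: sH; rewrite inE ys orbT.
  - by [].
  exists u'; split=> // y; rewrite inE => /orP[/eqP->|]; last exact: uE'.
  by exists c.
have [|u [u0 hu uE]] := eig (vbasis H); first by move=> x; exact: vbasis_mem.
exists u; split=> // x xH.
have /choice [c cE] (i : 'I_(\dim H)) : exists c, br (vbasis H)`_i u = c *: u.
  by apply: uE; rewrite mem_nth ?size_tuple.
exists (\sum_i coord (vbasis H) i x * c i).
rewrite {1}(coord_vbasis xH) (lie_suml lieV) scaler_suml.
by apply: eq_bigr => i _; rewrite cE scalerA.
Qed.

(** If [br h] is nonzero, the weight of a common eigenvector on which [h] acts by a nonzero scalar
    is a root that does not vanish at [h]. *)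
Lemma torus_ad_eq0 (h : subvs_of H) :
  (forall a : weight H, Defs.root br a -> a h = 0) -> forall v, br (vsval h) v = 0.
Proof.
move=> rh v; apply/eqP; apply: contraT => hv.
have [a [w [a0 w0 hw wE]]] := torus_common_eigenvector (subvsP h) hv.
have /choice [c cE] (x : subvs_of H) : exists c : F^o, br (vsval x) w = c *: w.
  exact: wE (subvsP x).
have c_uniq b d : b *: w = d *: w -> b = d.
  by move/eqP; rewrite -subr_eq0 -scalerBl scaler_eq0 (negPf w0) orbF subr_eq0 => /eqP.
have cL : linear c.
  move=> k x y; apply: c_uniq; rewrite -cE linearP (lieDl lieV) (lieZl lieV) !cE.
  by rewrite scalerA -scalerDl.
have lE x : linfun c x = c x by exact: (lfunE (linear_of cL)).
suff /rh : Defs.root br (linfun c : weight H).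
  rewrite lE => ch; move: a0.
  by rewrite -(c_uniq _ _ (etrans (esym (cE h)) hw)) ch eqxx.
split.
  apply: contraNneq a0 => c0; rewrite -(c_uniq _ _ (etrans (esym (cE h)) hw)).
  by rewrite -lE c0 zero_lfunE.
apply: contraNneq w0 => R0; rewrite -memv0 -R0.
by apply/(mem_root_space lieV) => x; rewrite lE.
Qed.

End TorusTheory.

(** The line spanned by a central element is an abelian ideal. *)
Lemma semisimple_center (F : fieldType) (V : vectType F) (br : V -> V -> V) h :
  lie_bracket br -> semisimple br -> (forall v, br h v = 0) -> h = 0.
Proof.
move=> lieV ssV hC; apply/eqP; rewrite -memv0 -(ssV <[h]>%VS) ?memv_line //.
  by move=> x y /vlineP[k ->]; rewrite (lieZr lieV) (lieC lieV) hC oppr0 scaler0 mem0v.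
exists 1%N; apply/eqP; rewrite /= -subv0; apply/span_subvP => x.
case/allpairsP=> -[y z] /= [/vbasis_mem/vlineP[k ->] _ ->].
by rewrite (lieZl lieV) hC scaler0 mem0v.
Qed.

(** * Structure of L *)

(* [br] is then the direct sum of [n] copies of the nonabelian algebra of
   dimension 2, [A0] being spanned by the [h i] and [A1] by the [e i]; linear
   independence follows from the bracket relations and [frame_neq0]. *)
Record borel_frame (F : fieldType) (V : vectType F) (br : V -> V -> V)
    (A0 A1 : {vspace V}) (n : nat) (h e : 'I_n -> V) : Prop := BorelFrame {
  frame_hh : forall i j, br (h i) (h j) = 0;
  frame_he : forall i j, br (h i) (e j) = e j *+ (i == j);
  frame_ee : forall i j, br (e i) (e j) = 0;
  frame_neq0 : forall i, e i != 0;
  frame_h_in : forall i, h i \in A0;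
  frame_e_in : forall i, e i \in A1;
  frame_span0 : forall v, v \in A0 -> exists a, v = \sum_i a i *: h i;
  frame_span1 : forall v, v \in A1 -> exists b, v = \sum_i b i *: e i;
  frame_sum : (A0 + A1)%VS = fullv
}.

Section QGradedStructure.
Variables (F : fieldType) (LL : vectType F) (br : LL -> LL -> LL).
Variables (H L : {vspace LL}).
Hypotheses (char0 : [pchar F] =i pred0) (lieL : lie_bracket br).
Hypotheses (ssL : semisimple br) (torH : torus br H).
Variable Psi : seq (weight H).
Hypotheses (algL : subalgebra br L) (HL : (H <= L)%VS).
Hypothesis rootPsi : forall a, a \in Psi -> Defs.root br a.
Hypothesis spanPsi :
  forall v, Zspan (fun a => a \in Psi) v <-> root_lattice br v.
Hypothesis dirL : directv (H + \sum_(a <- Psi) root_space br a).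
Hypothesis defL : L = (H + \sum_(a <- Psi) root_space br a)%VS.
Hypothesis dimL : \dim L = (2 * \dim (lie_comm br L L))%N.

Local Notation n := (size Psi).

(** Every root is an integral combination of [Psi], so all roots vanish at [x], which is then
    central. *)
Lemma Psi_separates (x : subvs_of H) : (forall a, a \in Psi -> a x = 0) -> x = 0.
Proof.
move=> x0; apply/val_inj/(semisimple_center lieL ssL)/(torus_ad_eq0 lieL torH) => a ra.
have /spanPsi[m [s [sPsi [c ->]]]] : root_lattice br a.
  exists 1%N, [tuple a]; split=> [b|]; first by rewrite inE => /eqP ->.
  by exists [ffun=> 1]; rewrite big_ord1 ffunE mulr1z.
rewrite sum_lfunE big1 // => i _.
by rewrite -scaler_int scale_lfunE x0 ?scaler0 // sPsi // mem_nth ?size_tuple.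
Qed.

Definition Psi_eval (x : subvs_of H) : 'rV[F]_n := \row_i (Psi`_i x : F).

Fact Psi_eval_linear : linear Psi_eval.
Proof. by move=> c x y; apply/rowP => i; rewrite !mxE linearP. Qed.

Lemma Psi_eval_inj : lker (linfun (linear_of Psi_eval_linear)) = 0%VS.
Proof.
apply/eqP/lker0P => x y; rewrite !lfunE /= => /rowP xy; apply/eqP.
rewrite -subr_eq0; apply/eqP/Psi_separates => a /(nthP 0)[i ltin <-].
by have := xy (Ordinal ltin); rewrite !mxE raddfB /= => ->; rewrite subrr.
Qed.

Lemma root_space_sub a : a \in Psi -> (root_space br a <= L)%VS.
Proof.
move=> aPsi; rewrite defL (big_rem a) //=.
exact: subv_trans (addvSl _ _) (addvSr _ _).
Qed.

(** A root vector [x] equals [[y, x]] divided by [a y], for any [y] in [H] with [a y != 0]. *)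
Lemma root_space_sub_comm a : a \in Psi -> (root_space br a <= lie_comm br L L)%VS.
Proof.
move=> aPsi; apply/subvP => x /[dup] xa /(mem_root_space lieL) xE.
have [x0 xneq0] : a != 0 /\ root_space br a != 0%VS by exact: rootPsi.
have [y ay] : exists y, a y != 0.
  have /existsNP[y /eqP ay] : ~ (forall y, a y = 0); last by exists y.
  by move=> a0; case/eqP: x0; apply/lfunP => y; rewrite a0 zero_lfunE.
have -> : x = (a y)^-1 *: br (vsval y) x by rewrite xE scalerA mulVf ?scale1r.
rewrite rpredZ // lie_comm_in //; first exact: (subvP HL) (subvsP y).
exact: (subvP (root_space_sub aPsi)).
Qed.

(** Let [r] be the sum of the dimensions of the root spaces. From [\dim H + r = 2 * \dim [L, L] >= 2
    * r] one gets [\dim H >= r >= n], while [Psi_separates] gives [\dim H <= n]. Hence equality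
    holds everywhere. *)
Lemma dim_torus_root_spaces :
  \dim H = n /\ forall a, a \in Psi -> \dim (root_space br a) = 1%N.
Proof.
pose r := (\sum_(a <- Psi) \dim (root_space br a))%N.
have dirS : directv (\sum_(a <- Psi) root_space br a).
  by move: dirL; rewrite directv_addE => /and3P[].
have dimHL : (\dim H + r = 2 * \dim (lie_comm br L L))%N.
  by rewrite -dimL defL; move: dirL; rewrite directvE /= => /eqP ->.
have r_le : (r <= \dim (lie_comm br L L))%N.
  have /directvP/= rE := dirS; rewrite /r -rE; apply: dimvS; rewrite big_seq.
  apply: (big_ind (fun U => U <= _)%VS); first exact: sub0v.
    by move=> U W sU sW; rewrite subv_add sU.
  exact: root_space_sub_comm.
have dim_gt0 a : a \in Psi -> (0 < \dim (root_space br a))%N.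
  by rewrite lt0n dimv_eq0 => /rootPsi[].
have rE : (r = \sum_(a <- Psi) (\dim (root_space br a)).-1 + n)%N.
  rewrite -sum1_size -big_split /r !big_seq; apply: eq_bigr => a /dim_gt0.
  by rewrite /= addn1 => /prednK.
have H_le : (\dim H <= n)%N.
  have -> : \dim H = \dim (linfun (linear_of Psi_eval_linear) @: fullv).
    by rewrite limg_dim_eq ?Psi_eval_inj ?capv0 // dimvf.
  by rewrite (leq_trans (dimvS (subvf _))) // dimvf dim_matrix mul1r.
have Hn : \dim H = n by lia.
split=> // a aPsi.
have : (\sum_(a <- Psi) (\dim (root_space br a)).-1 == 0)%N by lia.
rewrite sum_nat_seq_eq0 => /allP/(_ _ aPsi)/eqP d0.
by have := dim_gt0 a aPsi; lia.
Qed.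

(** [Psi_eval] is injective between spaces of the same dimension, so the unit row vectors have
    preimages [h i]. The coordinates of [x] are its values under [Psi]. *)
Lemma torus_dual_basis : exists h : 'I_n -> subvs_of H,
  (forall i j : 'I_n, (Psi`_j) (h i) = (i == j)%:R) /\
  forall x, exists a, x = \sum_i a i *: h i.
Proof.
have full : limg (linfun (linear_of Psi_eval_linear)) = fullv.
  apply/eqP; rewrite eqEdim subvf limg_dim_eq ?Psi_eval_inj ?capv0 // !dimvf.
  by rewrite /= dim_matrix mul1r -(proj1 dim_torus_root_spaces) leqnn.
have /choice [h hE] (i : 'I_n) : exists x, delta_mx 0 i = Psi_eval x.
  have /memv_imgP[x _] : (delta_mx 0 i : 'rV[F]_n) \in
    limg (linfun (linear_of Psi_eval_linear)) by rewrite full memvf.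
  by rewrite lfunE; exists x.
have hd (i j : 'I_n) : (Psi`_j) (h i) = (i == j)%:R.
  by have /rowP/(_ j) := hE i; rewrite !mxE eqxx eq_sym => <-.
exists h; split=> // x; exists (fun i : 'I_n => Psi`_i x); apply/eqP.
rewrite -subr_eq0; apply/eqP/Psi_separates => a /(nthP 0)[i ltin <-].
pose j := Ordinal ltin; rewrite linearB linear_sum (bigD1 j) //= big1 => [|k kj].
  by rewrite linearZ /= (hd j j) eqxx [_ *: 1]mulr1 addr0 subrr.
by rewrite linearZ /= (hd k j) (negPf kj) scaler0.
Qed.

Lemma Q_graded_frame : exists h e : 'I_n -> subvs_of L,
  borel_frame (sub_br br (U := L)) (subv_in L H) (subv_in L (lie_comm br L L)) h e.
Proof.
have [_ dim1] := dim_torus_root_spaces; have [h [hd hspan]] := torus_dual_basis.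
have PsiP (i : 'I_n) : Psi`_i \in Psi by exact: mem_nth.
pose e (i : 'I_n) := vpick (root_space br Psi`_i).
have e0 i : e i != 0 by rewrite vpick0 -dimv_eq0 dim1 //.
have eE (i : 'I_n) : root_space br Psi`_i = <[e i]>%VS.
  apply/esym/eqP; rewrite eqEdim -memvE memv_pick dim_vline e0 dim1 //.
have hH i : vsval (h i) \in H by exact: subvsP.
have he x (i : 'I_n) : br (vsval x) (e i) = (Psi`_i x : F) *: e i.
  by move: x; apply/(mem_root_space lieL)/memv_pick.
have hei i j : br (vsval (h i)) (e j) = e j *+ (i == j).
  by rewrite he hd scaler_nat.
have Lspan v : v \in L -> exists a b, v = \sum_i a i *: vsval (h i) + \sum_i b i *: e i.
  rewrite {1}defL => /memv_addP[x xH [y yS ->]].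
  have [a aE] := hspan (vsproj H x); exists a.
  have -> : x = \sum_i a i *: vsval (h i).
    rewrite -[x in LHS](vsprojK xH) aE linear_sum.
    by apply: eq_bigr => i _; rewrite linearZ.
  move: yS; rewrite (big_nth 0) big_mkord => /memv_sumP[u uE ->].
  have /choice [b bE] (i : 'I_n) : exists b, u i = b *: e i.
    by apply/vlineP; rewrite -eE uE.
  by exists b; congr (_ + _); apply: eq_bigr.
have eL i : e i \in L by rewrite (subvP (root_space_sub (PsiP i))) ?memv_pick.
  (* The element [hs] acts as 0 on [H] and as 1 on [E], so [L = H + E] contains no eigenvector of
     eigenvalue 2. *)
  pose hs := \sum_i vsval (h i); pose E := (\sum_i <[e i]>)%VS.
have memE (b : 'I_n -> F) : \sum_i b i *: e i \in E.
  by apply: memv_sumr => i _; rewrite rpredZ ?memv_line.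
have Espan v : v \in E -> exists b, v = \sum_i b i *: e i.
  case/memv_sumP=> u uE ->.
  have /choice [b bE] (i : 'I_n) : exists b, u i = b *: e i by apply/vlineP/uE.
  by exists b; apply: eq_bigr.
have hs_h x : x \in H -> br hs x = 0.
  by move=> xH; apply: (torus_abelian lieL torH) => //; apply: rpred_sum.
have hs_e i : br hs (e i) = e i.
  rewrite /hs (lie_big_suml lieL) (bigD1 i) //= hei eqxx big1 ?addr0 // => k ki.
  by rewrite hei (negPf ki).
have hs_E v : v \in E -> br hs v = v.
  case/Espan=> b ->; rewrite (lie_big_sumr lieL); apply: eq_bigr => i _.
  by rewrite (lieZr lieL) hs_e.
have two_neq0 : (2 : F) != 0.
  by have := char0 2; rewrite !inE /= => /negbT.
have LHE v : v \in L -> exists x y, [/\ x \in H, y \in E & v = x + y].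
  case/Lspan=> a [b ->]; exists (\sum_i a i *: vsval (h i)), (\sum_i b i *: e i).
  by split=> //; apply: rpred_sum => i _; rewrite rpredZ.
have hee i j : br (e i) (e j) = 0.
  have [x [y [xH yE w]]] := LHE _ (algL (eL i) (eL j)).
  have : br hs (br (e i) (e j)) = 2 *: br (e i) (e j).
    by rewrite (lie_derivation lieL) !hs_e scaler_nat mulr2n.
  (* With [[e i, e j] = x + y] this reads [y = 2 (x + y)]. A second application of [hs] gives
     [y = 2 y], so [y = 0] and then [2 x = 0]. *)
  rewrite w (lieDr lieL) (hs_h x) // (hs_E y) // add0r => yw.
  have y0 : y = 0.
    have := congr1 (br hs) yw; rewrite (lieZr lieL) (lieDr lieL).
    rewrite (hs_h x) // (hs_E y) // add0r.
    by move/eqP; rewrite scaler_nat mulr2n -subr_eq0 opprD addNKr oppr_eq0 => /eqP.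
  by move/esym/eqP: yw; rewrite y0 addr0 scaler_eq0 (negPf two_neq0) => /eqP.
(* For the inclusion of the commutator in [E]: [[H, H]] and [[E, E]] vanish, and [[H, E]] lies in
   [E]. *)
have E_comm : E = lie_comm br L L.
  apply/eqP; rewrite eqEsubv; apply/andP; split.
    apply/subv_sumP => i _; rewrite -memvE.
    exact: (subvP (root_space_sub_comm (PsiP i))) (memv_pick _).
  have heE x y : x \in H -> y \in E -> br x y \in E.
    move=> xH /Espan[b ->]; rewrite -[x](vsprojK xH) (lie_big_sumr lieL).
    apply: memv_sumr => i _.
    by rewrite (lieZr lieL) he !rpredZ ?memv_line.
  apply/span_subvP => _ /allpairsP[[u v] /= [/vbasis_mem uL /vbasis_mem vL ->]].
  have [x [y [xH yE ->]]] := LHE u uL; have [x' [y' [x'H y'E ->]]] := LHE v vL.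
  rewrite !(lieDl lieL) !(lieDr lieL) (torus_abelian lieL torH) // add0r.
  apply: rpredD; first exact: heE.
  apply: rpredD; first by rewrite (lieC lieL) rpredN heE.
  have [[b ->] [c ->]] := (Espan _ yE, Espan _ y'E).
  rewrite (lie_big_suml lieL); apply: rpred_sum => i _.
  rewrite (lie_big_sumr lieL); apply: rpred_sum => j _.
  by rewrite (lieZl lieL) (lieZr lieL) hee !scaler0 mem0v.
have hL i : vsval (h i) \in L by exact: (subvP HL).
exists (vsproj L \o vsval \o h), (vsproj L \o e).
have val_h i : vsval ((vsproj L \o vsval \o h) i) = vsval (h i) by rewrite vsprojK.
have val_e i : vsval ((vsproj L \o e) i) = e i by rewrite vsprojK.
have vsL v : vsval v \in L := subvsP v.
split.
- by move=> i j; apply: subvs_inj; rewrite sub_brE // !val_h (torus_abelian lieL torH).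
- by move=> i j; apply: subvs_inj; rewrite sub_brE // val_h val_e hei linearMn /= val_e.
- by move=> i j; apply: subvs_inj; rewrite sub_brE // !val_e hee.
- by move=> i; rewrite -(inj_eq subvs_inj) val_e.
- by move=> i; rewrite mem_subv_in val_h.
- move=> i; rewrite mem_subv_in val_e -E_comm.
  exact: (subvP (sumv_sup i isT (subvv _))) (memv_line _).
- move=> v; rewrite mem_subv_in => vH; have [a aE] := hspan (vsproj H (vsval v)).
  exists a; apply: subvs_inj; rewrite -[val v](vsprojK vH) aE !linear_sum.
  by apply: eq_bigr => i _; rewrite !linearZ /= val_h.
- move=> v; rewrite mem_subv_in -E_comm => /Espan[b bE].
  exists b; apply: subvs_inj; rewrite /= bE linear_sum.
  by apply: eq_bigr => i _; rewrite linearZ /= val_e.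
apply/vspaceP => v; rewrite memvf.
have [x [y [xH yE vE]]] := LHE _ (subvsP v).
have xL := subvP HL x xH; have yL : y \in L.
  by rewrite -[y](addKr x) -vE rpredD ?rpredN.
have -> : v = vsproj L x + vsproj L y.
  by apply: subvs_inj; rewrite linearD /= !vsprojK.
by rewrite memv_add // mem_subv_in vsprojK // -E_comm.
Qed.

End QGradedStructure.

(** * Loop algebra *)

Section LaurentBracket.
Variables (F : fieldType) (V : lmodType F) (br : V -> V -> V).
Hypothesis lieV : lie_bracket br.
Implicit Types u v w : laurent V.

Lemma laurent_brE u v k :
  (laurent_br br u v)@_k = \sum_(i <- msupp u) br u@_i v@_(k - i).
Proof.
rewrite /laurent_br (raddf_sum (mcoeff k)); apply: eq_bigr => i _.
rewrite (raddf_sum (mcoeff k)) /= [in RHS](monalgE v) (raddf_sum (mcoeff (k - i))).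
rewrite (lie_big_sumr lieV); apply: eq_bigr => j _; rewrite /= !mcoeffU.
by rewrite addrC eq_sym -subr_eq eq_sym; case: eqP => _ //; rewrite (lie0r lieV).
Qed.

Lemma laurent_brC u v : laurent_br br u v = - laurent_br br v u.
Proof.
rewrite /laurent_br exchange_big -sumrN; apply: eq_bigr => j _.
rewrite -sumrN; apply: eq_bigr => i _.
by rewrite (lieC lieV) addrC; apply/malgP => k; rewrite mcoeffN !mcoeffU mulNrn.
Qed.

Lemma laurent_br_linearr u : linear (laurent_br br u).
Proof.
move=> c v w; apply/malgP => k; rewrite mcoeffD lcoeffZ !laurent_brE scaler_sumr.
rewrite -big_split; apply: eq_bigr => i _ /=.
by rewrite mcoeffD lcoeffZ (lie_linearr lieV).
Qed.

Lemma laurent_br_linearl v : linear ((laurent_br br)^~ v).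
Proof.
move=> c u w; rewrite /= laurent_brC laurent_br_linearr opprD.
by rewrite -scalerN -!laurent_brC.
Qed.

Lemma laurent_brUE a i v k : (laurent_br br << a *g i >> v)@_k = br a v@_(k - i).
Proof.
have GD j : {morph (fun b => br b v@_(k - j)) : b c / b + c}.
  by move=> b c; rewrite (lieDl lieV).
by rewrite laurent_brE (laurent_extU GD).
Qed.

Lemma laurent_brU a i b j :
  laurent_br br << a *g i >> << b *g j >> = << br a b *g i + j >>.
Proof.
apply/malgP => k; rewrite laurent_brUE !mcoeffU [i + j]addrC eq_sym subr_eq eq_sym.
by case: eqP => // _; rewrite (lie0r lieV).
Qed.

End LaurentBracket.

(** * Coordinates with respect to a frame *)

Section Coordinates.
Variables (F : fieldType) (V : vectType F) (br : V -> V -> V).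
Variables (A0 A1 : {vspace V}) (n : nat) (h e : 'I_n -> V).
Hypotheses (lieV : lie_bracket br) (frV : borel_frame br A0 A1 h e).

(** The last two clauses express both coordinates by brackets, so that identities between
    coordinates reduce to bracket identities by [frame_e_inj]. *)
Definition frame_coords (xi eta : 'I_n -> {linear V -> F^o}) : Prop :=
  [/\ forall v, v = \sum_i xi i v *: h i + \sum_i eta i v *: e i,
      forall i v, br v (e i) = xi i v *: e i &
      forall i v, br (h i) v = eta i v *: e i].

Lemma frame_e_inj i (c d : F) : c *: e i = d *: e i -> c = d.
Proof.
move/eqP; rewrite -subr_eq0 -scalerBl scaler_eq0 (negPf (frame_neq0 frV i)) orbF.
by rewrite subr_eq0 => /eqP.
Qed.

(** The coefficients are first chosen arbitrarily; the bracket relations with [e i] and [h i] then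
    determine them, which makes them linear in [v]. *)
Lemma frame_coords_exist : exists xi eta, frame_coords xi eta.
Proof.
have /choice [a /choice [b abE]] v : exists a : 'I_n -> F, exists b : 'I_n -> F,
    v = \sum_i a i *: h i + \sum_i b i *: e i.
  have : v \in (A0 + A1)%VS by rewrite (frame_sum frV) memvf.
  case/memv_addP=> x /(frame_span0 frV)[a ->] [y /(frame_span1 frV)[b ->] ->].
  by exists a, b.
have aE i v : br v (e i) = a v i *: e i.
  rewrite {1}[v]abE (lieDl lieV) !(lie_big_suml lieV) [X in _ + X]big1 ?addr0 => [|j _].
    rewrite (bigD1 i) //= big1 ?addr0 => [|j ji].
      by rewrite (lieZl lieV) (frame_he frV) eqxx.
    by rewrite (lieZl lieV) (frame_he frV) (negPf ji) scaler0.
  by rewrite (lieZl lieV) (frame_ee frV) scaler0.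
have bE i v : br (h i) v = b v i *: e i.
  rewrite {1}[v]abE (lieDr lieV) !(lie_big_sumr lieV) [X in X + _]big1 ?add0r => [|j _].
    rewrite (bigD1 i) //= big1 ?addr0 => [|j ji].
      by rewrite (lieZr lieV) (frame_he frV) eqxx.
    by rewrite (lieZr lieV) (frame_he frV) eq_sym (negPf ji) scaler0.
  by rewrite (lieZr lieV) (frame_hh frV) scaler0.
have aL i : linear (fun v => a v i : F^o).
  move=> c u v; apply: (@frame_e_inj i).
  by rewrite -aE (lieDl lieV) (lieZl lieV) !aE scalerA -scalerDl.
have bL i : linear (fun v => b v i : F^o).
  move=> c u v; apply: (@frame_e_inj i).
  by rewrite -bE (lieDr lieV) (lieZr lieV) !bE scalerA -scalerDl.
by exists (fun i => linear_of (aL i)), (fun i => linear_of (bL i)); split.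
Qed.

Variables xi eta : 'I_n -> {linear V -> F^o}.
Hypothesis coV : frame_coords xi eta.

Lemma coordE v : v = \sum_i xi i v *: h i + \sum_i eta i v *: e i.
Proof. by case: coV. Qed.

Lemma xiE i v : br v (e i) = xi i v *: e i.
Proof. by case: coV. Qed.

Lemma etaE i v : br (h i) v = eta i v *: e i.
Proof. by case: coV. Qed.

Lemma xi_h i j : xi i (h j) = (i == j)%:R.
Proof. by apply: (@frame_e_inj i); rewrite -xiE (frame_he frV) eq_sym scaler_nat. Qed.

Lemma xi_e i j : xi i (e j) = 0.
Proof. by apply: (@frame_e_inj i); rewrite -xiE (frame_ee frV) scale0r. Qed.

Lemma eta_h i j : eta i (h j) = 0.
Proof. by apply: (@frame_e_inj i); rewrite -etaE (frame_hh frV) scale0r. Qed.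

Lemma eta_e i j : eta i (e j) = (i == j)%:R.
Proof.
apply: (@frame_e_inj i); rewrite -etaE (frame_he frV) scaler_nat.
by case: eqP => // ->.
Qed.

(** Both [u] and [v] act on [e i] by scalars, which commute, so [[u, v]] acts on it by 0. *)
Lemma xi_br i u v : xi i (br u v) = 0.
Proof.
apply: (@frame_e_inj i); rewrite -xiE scale0r.
have := lie_derivation lieV u v (e i).
rewrite !xiE !(lieZr lieV) !xiE !scalerA [xi i u * _]mulrC => /eqP.
by rewrite -subr_eq subrr eq_sym => /eqP.
Qed.

(** Apply the derivation [br (h i)] to [[u, v]]; it sends [u] and [v] to multiples of [e i]. *)
Lemma eta_br i u v : eta i (br u v) = xi i u * eta i v - xi i v * eta i u.
Proof.
apply: (@frame_e_inj i); rewrite -etaE (lie_derivation lieV) !etaE.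
rewrite (lieZl lieV) (lieZr lieV) (lieC lieV (e i)) !xiE scalerN !scalerA.
by rewrite addrC scalerBl mulrC [eta i u * _]mulrC.
Qed.

Lemma coord_eq u v :
  (forall i, xi i u = xi i v) -> (forall i, eta i u = eta i v) -> u = v.
Proof.
move=> xuv euv; rewrite [u]coordE [v]coordE.
by congr (_ + _); apply: eq_bigr => i _; rewrite ?xuv ?euv.
Qed.

Lemma memA0 v : v \in A0 <-> forall i, eta i v = 0.
Proof.
split=> [/(frame_span0 frV)[a ->] i|ev].
  by rewrite linear_sum big1 // => j _; rewrite linearZ /= eta_h scaler0.
rewrite [v]coordE [X in _ + X]big1 => [|i _]; last by rewrite ev scale0r.
by rewrite addr0; apply: rpred_sum => i _; rewrite rpredZ ?(frame_h_in frV).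
Qed.

Lemma memA1 v : v \in A1 <-> forall i, xi i v = 0.
Proof.
split=> [/(frame_span1 frV)[a ->] i|ev].
  by rewrite linear_sum big1 // => j _; rewrite linearZ /= xi_e scaler0.
rewrite [v]coordE [X in X + _]big1 => [|i _]; last by rewrite ev scale0r.
by rewrite add0r; apply: rpred_sum => i _; rewrite rpredZ ?(frame_e_in frV).
Qed.

End Coordinates.

(** * Parity of exponents and coefficientwise linear maps *)

Lemma dvd2_even (m : int) : (2 %| 2 * m)%Z. Proof. exact: dvdz_mulr. Qed.

Lemma dvd2_odd (m : int) : (2 %| 2 * m + 1)%Z = false. Proof. by lia. Qed.

Lemma even_or_odd (k : int) : exists m : int, k = 2 * m \/ k = 2 * m + 1.
Proof. by exists (k %/ 2)%Z; lia. Qed.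

Section TwvalLinear.
Variables (F : fieldType) (V : vectType F) (A0 A1 : {vspace V}).

Fact twval_linear : linear (@twval F V A0 A1).
Proof. exact: (linearP (val : twloop A0 A1 -> laurent V)). Qed.

Definition twval0 := lin0 twval_linear.
Definition twvalD := linD twval_linear.
Definition twvalZ := linZ twval_linear.
Definition twvalN := linN twval_linear.
Definition twvalMn := linMn twval_linear.
Definition twval_sum := lin_sum twval_linear.

Lemma twval_inj : injective (@twval F V A0 A1).
Proof. exact: val_inj. Qed.

End TwvalLinear.

Section LaurentMap.
Variables (F : fieldType) (V : lmodType F).

Definition laurent_map (f : {linear V -> F^o}) (u : laurent V) : laurent F^o :=
  \sum_(k <- msupp u) << f u@_k *g k >>.

Lemma laurent_mapE f u k : (laurent_map f u)@_k = f u@_k.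
Proof.
rewrite {2}[u]monalgE /laurent_map !(raddf_sum (mcoeff k)) linear_sum.
by apply: eq_bigr => j _; rewrite /= !mcoeffU raddfMn.
Qed.

End LaurentMap.

Section Parity.
Variable F : fieldType.

Lemma in_RP (r : laurent F^o) : r \in in_R <-> forall m, r@_(2 * m + 1) = 0.
Proof.
split=> [/twistedP rR m|r0].
  by have := rR (2 * m + 1); rewrite dvd2_odd memv0 => /eqP.
apply/twistedP => k; have [m [->|->]] := even_or_odd k.
  by rewrite dvd2_even memvf.
by rewrite dvd2_odd memv0 r0.
Qed.

Lemma in_RtP (r : laurent F^o) : r \in in_Rt <-> forall m, r@_(2 * m) = 0.
Proof.
split=> [/twistedP rR m|r0].
  by have := rR (2 * m); rewrite dvd2_even memv0 => /eqP.
apply/twistedP => k; have [m [->|->]] := even_or_odd k.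
  by rewrite dvd2_even memv0 r0.
by rewrite dvd2_odd memvf.
Qed.

End Parity.

(** * The twisted loop algebra in coordinates *)

Section LoopFrame.
Variables (F : fieldType) (V : vectType F) (br : V -> V -> V).
Variables (A0 A1 : {vspace V}) (n : nat) (h e : 'I_n -> V).
Variables xi eta : 'I_n -> {linear V -> F^o}.
Hypotheses (lieV : lie_bracket br) (frV : borel_frame br A0 A1 h e).
Hypothesis coV : frame_coords br h e xi eta.

Local Notation Lbar := (twloop A0 A1).
Local Notation "x ~_ k" := ((twval x)@_k) (at level 3).
Implicit Types (x y z : Lbar) (i j c : 'I_n) (m k : int).

Fact h_loop_mem i m : << h i *g 2 * m >> \in twisted A0 A1.
Proof.
apply/twistedP => k; rewrite mcoeffU.
have [<-|_] := eqVneq; first by rewrite dvd2_even (frame_h_in frV).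
by case: ifP; rewrite mem0v.
Qed.

Fact e_loop_mem i m : << e i *g 2 * m + 1 >> \in twisted A0 A1.
Proof.
apply/twistedP => k; rewrite mcoeffU.
have [<-|_] := eqVneq; first by rewrite dvd2_odd (frame_e_in frV).
by case: ifP; rewrite mem0v.
Qed.

Definition h_loop i m : Lbar := TwLoop (h_loop_mem i m).
Definition e_loop i m : Lbar := TwLoop (e_loop_mem i m).

Lemma twisted_coords (u : laurent V) :
  u \in twisted A0 A1 <->
  forall i m, eta i u@_(2 * m) = 0 /\ xi i u@_(2 * m + 1) = 0.
Proof.
split=> [/twistedP uA i m | uA].
  have := uA (2 * m); have := uA (2 * m + 1); rewrite dvd2_even dvd2_odd.
  by move=> /(memA1 frV coV) u1 /(memA0 frV coV) u0.
apply/twistedP => k; have [m [->|->]] := even_or_odd k.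
  by rewrite dvd2_even; apply/(memA0 frV coV) => i; case: (uA i m).
by rewrite dvd2_odd; apply/(memA1 frV coV) => i; case: (uA i m).
Qed.

Lemma eta_even x i m : eta i x~_(2 * m) = 0.
Proof. by have /twisted_coords/(_ i m)[] := valP x. Qed.

Lemma xi_odd x i m : xi i x~_(2 * m + 1) = 0.
Proof. by have /twisted_coords/(_ i m)[] := valP x. Qed.

Lemma laurent_coord_eq (u v : laurent V) :
  (forall i k, xi i u@_k = xi i v@_k) -> (forall i k, eta i u@_k = eta i v@_k) ->
  u = v.
Proof. by move=> xuv euv; apply/malgP => k; apply: (coord_eq coV). Qed.

(** The coordinate formulas for brackets give the grading conditions under which [loop_br] never
    takes its default value. *)
Lemma twval_loop_br x y :
  twval (loop_br br x y) = laurent_br br (twval x) (twval y).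
Proof.
have m0 := memA0 frV coV; have m1 := memA1 frV coV.
apply: loop_brE => a b.
- move=> /m0 a0 /m0 b0; apply/m0 => i.
  by rewrite (eta_br lieV frV coV) a0 b0 !mulr0 subr0.
- by move=> _ _; apply/m1 => i; rewrite (xi_br lieV frV coV).
- by move=> _ _; apply/m1 => i; rewrite (xi_br lieV frV coV).
move=> /m1 a0 /m1 b0; apply/m0 => i.
by rewrite (eta_br lieV frV coV) a0 b0 !mul0r subr0.
Qed.

(* Abstract, since unification would unfold the [insubd] of [loop_br br]. *)
Variable lbr : Lbar -> Lbar -> Lbar.
Hypothesis lbrE : forall x y, twval (lbr x y) = laurent_br br (twval x) (twval y).

Lemma loop_brC x y : lbr x y = - lbr y x.
Proof. by apply: twval_inj; rewrite lbrE twvalN lbrE (laurent_brC lieV). Qed.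

Lemma loop_br_linearl y : linear (lbr^~ y).
Proof.
move=> c x z; apply: twval_inj; rewrite !(twvalD, twvalZ, lbrE).
exact: (laurent_br_linearl lieV).
Qed.

Lemma loop_br_linearr x : linear (lbr x).
Proof.
move=> c y z; apply: twval_inj; rewrite !(twvalD, twvalZ, lbrE).
exact: (laurent_br_linearr lieV).
Qed.

Lemma xi_loop_br c x y k : xi c (lbr x y)~_k = 0.
Proof.
rewrite lbrE (laurent_brE lieV) linear_sum big1 // => i _.
exact: (xi_br lieV frV coV).
Qed.

Lemma eta_h_loop_br c i m y k :
  eta c (lbr (h_loop i m) y)~_k = eta c y~_(k - 2 * m) *+ (i == c).
Proof.
rewrite lbrE (laurent_brUE lieV) (eta_br lieV frV coV).
rewrite (xi_h frV coV) (eta_h frV coV) mulr0 subr0 eq_sym.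
by case: eqP; rewrite ?mul0r ?mul1r.
Qed.

Lemma eta_e_loop_br c i m y k :
  eta c (lbr (e_loop i m) y)~_k = - xi c y~_(k - (2 * m + 1)) *+ (i == c).
Proof.
rewrite lbrE (laurent_brUE lieV) (eta_br lieV frV coV).
rewrite (xi_e frV coV) (eta_e frV coV) mul0r sub0r eq_sym.
by case: eqP; rewrite ?mulr0 ?mulr1 ?oppr0.
Qed.

Lemma loop_br_hh i m j m' : lbr (h_loop i m) (h_loop j m') = 0.
Proof.
apply: twval_inj; rewrite lbrE (laurent_brU lieV) (frame_hh frV).
by apply/malgP => k; rewrite mcoeffU mul0rn mcoeff0.
Qed.

Lemma loop_br_ee i m j m' : lbr (e_loop i m) (e_loop j m') = 0.
Proof.
apply: twval_inj; rewrite lbrE (laurent_brU lieV) (frame_ee frV).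
by apply/malgP => k; rewrite mcoeffU mul0rn mcoeff0.
Qed.

Lemma loop_br_he i m j m' :
  lbr (h_loop i m) (e_loop j m') = e_loop j (m + m') *+ (i == j).
Proof.
apply: twval_inj; rewrite twvalMn lbrE (laurent_brU lieV) (frame_he frV).
by apply/malgP => k; rewrite mcoeffMn !mcoeffU mulrDr addrA mulrnAC.
Qed.

(** At even [k] only the [xi] survive and at odd [k] only the [eta], so [k %/ 2] is the correct
    index for both families. *)
Lemma loop_decomp x : x = \sum_(k <- msupp (twval x)) \sum_i
  ((xi i x~_k : F) *: h_loop i (k %/ 2)%Z + (eta i x~_k : F) *: e_loop i (k %/ 2)%Z).
Proof.
apply: twval_inj; rewrite twval_sum {1}[twval x]monalgE; apply: eq_bigr => k _.
rewrite twval_sum {1}(coordE coV x~_k).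
have -> : << \sum_i xi i x~_k *: h i + \sum_i eta i x~_k *: e i *g k >> =
    \sum_i << xi i x~_k *: h i + eta i x~_k *: e i *g k >>.
  by rewrite -big_split raddf_sum.
apply: eq_bigr => i _; rewrite twvalD !twvalZ; apply/malgP => k'.
rewrite [RHS]mcoeffD [X in _ = X + _]lcoeffZ [X in _ = _ + X]lcoeffZ !mcoeffU.
have [m [->|->]] := even_or_odd k.
  have -> : (2 * m %/ 2)%Z = m by lia.
  by rewrite eta_even !scale0r !addr0 scalerMnr.
have -> : ((2 * m + 1) %/ 2)%Z = m by lia.
by rewrite xi_odd !scale0r !add0r scalerMnr.
Qed.

Lemma loop_linear_eq (W : lmodType F) (f g : Lbar -> W) :
    linear f -> linear g ->
    (forall i m, f (h_loop i m) = g (h_loop i m)) ->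
    (forall i m, f (e_loop i m) = g (e_loop i m)) ->
  f =1 g.
Proof.
move=> fL gL fgh fge x; rewrite [x]loop_decomp !(lin_sum fL, lin_sum gL).
apply: eq_bigr => k _; rewrite !(lin_sum fL, lin_sum gL); apply: eq_bigr => i _.
by rewrite !(linD fL, linD gL, linZ fL, linZ gL) fgh fge.
Qed.

(* In coordinates: [phi] maps [h_i t^(2m)] to
   [m t^(2m-2) f_i h_i + t^(2m) b_i e_i] and [e_i t^(2m+1)] to
   [(m t^(2m-1) f_i + t^(2m+1) g_i) e_i]. *)
Definition normal_form (f g b : 'I_n -> laurent F^o) (phi : Lbar -> laurent V) : Prop :=
  forall i m c k,
  [/\ xi c (phi (h_loop i m))@_k = (m%:~R * (f i)@_(k - (2 * m - 2))) *+ (i == c),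
      eta c (phi (h_loop i m))@_k = (b i)@_(k - 2 * m) *+ (i == c),
      xi c (phi (e_loop i m))@_k = 0 &
      eta c (phi (e_loop i m))@_k =
        (m%:~R * (f i)@_(k - (2 * m - 1)) + (g i)@_(k - (2 * m + 1))) *+ (i == c)].

Lemma normal_form_eq f g b phi psi : linear phi -> linear psi ->
  normal_form f g b phi -> normal_form f g b psi -> phi =1 psi.
Proof.
move=> phiL psiL phiN psiN; apply: loop_linear_eq => // i m;
  apply: laurent_coord_eq => c k;
  have [p1 p2 p3 p4] := phiN i m c k; have [q1 q2 q3 q4] := psiN i m c k.
- by rewrite p1 q1.
- by rewrite p2 q2.
- by rewrite p3 q3.
- by rewrite p4 q4.
Qed.

(** The parity of [f], [g] and [b] makes the values of [phi] twisted. The Leibniz rule is linear in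
    each argument and stable under exchanging them, so it is checked on the pairs of generators
    [hh], [he] and [ee] only. *)
Lemma normal_form_derivation f g b phi :
    (forall i, f i \in in_R) -> (forall i, g i \in in_R) -> (forall i, b i \in in_Rt) ->
    linear phi -> normal_form f g b phi ->
  exists D : Lbar -> Lbar, derivation lbr D /\ forall x, twval (D x) = phi x.
Proof.
move=> fR gR bR phiL phiN.
have evenP (r : laurent F^o) m (rR : r \in in_R) := proj1 (in_RP r) rR m.
have oddP (r : laurent F^o) m (rR : r \in in_Rt) := proj1 (in_RtP r) rR m.
(* The coordinates that must vanish are coefficients of [f], [g] at odd exponents and of [b] at even
   ones. *)
have phi_tw x : phi x \in twisted A0 A1.
  rewrite [x]loop_decomp (lin_sum phiL); apply: rpred_sum => k _.
  rewrite (lin_sum phiL); apply: rpred_sum => i _.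
  rewrite (linD phiL) !(linZ phiL); move: (k %/ 2)%Z => m.
  apply: rpredD; apply: rpredZ; apply/twisted_coords => c k'.
    have [_ -> _ _] := phiN i m c (2 * k'); have [-> _ _ _] := phiN i m c (2 * k' + 1).
    have -> : 2 * k' - 2 * m = 2 * (k' - m) by ring.
    have -> : 2 * k' + 1 - (2 * m - 2) = 2 * (k' - m + 1) + 1 by ring.
    by rewrite evenP // oddP // mulr0 !mul0rn.
  have [_ _ _ ->] := phiN i m c (2 * k'); have [_ _ -> _] := phiN i m c (2 * k' + 1).
  have -> : 2 * k' - (2 * m - 1) = 2 * (k' - m) + 1 by ring.
  have -> : 2 * k' - (2 * m + 1) = 2 * (k' - m - 1) + 1 by ring.
  by rewrite !evenP // mulr0 addr0 mul0rn.
have [D [DL DE]] : exists D : Lbar -> Lbar, linear D /\ forall x, twval (D x) = phi x.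
  exists (fun x => TwLoop (phi_tw x)); split=> // c x y.
  by apply: twval_inj; rewrite twvalD twvalZ; exact: phiL.
have {}phiN : normal_form f g b (twval \o D).
  by move=> i m c k; rewrite /= !DE; exact: phiN.
exists D; split=> //; split=> //.
pose leib x y := D (lbr x y) = lbr (D x) y + lbr x (D y).
have leibC x y : leib x y -> leib y x.
  rewrite /leib => xy; rewrite (loop_brC y x) (linN DL) xy opprD.
  by rewrite (loop_brC (D y)) (loop_brC y); exact: addrC.
have lL y : linear (fun x => D (lbr x y)).
  by move=> c x z; rewrite (loop_br_linearl y) DL.
have rL y : linear (fun x => lbr (D x) y + lbr x (D y)).
  move=> c x z; rewrite DL (loop_br_linearl y) (loop_br_linearl (D y)).
  by rewrite scalerDr addrACA.
have gen y : (forall i m, leib (h_loop i m) y) -> (forall i m, leib (e_loop i m) y) ->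
    forall x, leib x y.
  by move=> yh ye x; exact: (loop_linear_eq (lL y) (rL y) yh ye).
have D0 := lin0 DL.
have hh i m j m' : leib (h_loop i m) (h_loop j m').
  rewrite /leib loop_br_hh D0; apply: twval_inj; apply: laurent_coord_eq => c k.
    by rewrite twval0 mcoeff0 linear0 twvalD mcoeffD linearD /= !xi_loop_br addr0.
  rewrite twval0 mcoeff0 linear0 twvalD mcoeffD linearD /= (loop_brC (D _)).
  rewrite twvalN mcoeffN linearN /=.
  rewrite !eta_h_loop_br.
  have [_ -> _ _] := phiN i m c (k - 2 * m').
  have [_ -> _ _] := phiN j m' c (k - 2 * m).
  rewrite -!mulrnA !mulnb.
  (* Only [i = j = c] contributes; both terms are then the coefficient of [b i] at
     [k - 2 * m - 2 * m'], with opposite signs. *)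
  have [<-|_] := eqVneq i c; last by rewrite andbF !mulr0n oppr0 addr0.
  have [->|_] := eqVneq j i; last by rewrite andbF !mulr0n oppr0 addr0.
  by rewrite addrAC addNr.
have he i m j m' : leib (h_loop i m) (e_loop j m').
  rewrite /leib loop_br_he; apply: twval_inj; apply: laurent_coord_eq => c k.
    rewrite (linMn DL) twvalMn mcoeffMn linearMn twvalD mcoeffD linearD /= !xi_loop_br.
    by have [_ _ -> _] := phiN j (m + m') c k; rewrite mul0rn addr0.
  rewrite (linMn DL) twvalMn mcoeffMn linearMn twvalD mcoeffD linearD /=.
  rewrite (loop_brC (D _)) twvalN mcoeffN linearN /= eta_h_loop_br eta_e_loop_br.
  have [_ _ _ ->] := phiN j (m + m') c k.
  have [-> _ _ _] := phiN i m c (k - (2 * m' + 1)).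
  have [_ _ _ ->] := phiN j m' c (k - 2 * m).
  have [<-|] := eqVneq i c; last first.
    move=> ic; rewrite !mulr0n oppr0 mul0rn oppr0 addr0.
    by have [<-|_] := eqVneq i j; rewrite ?(negPf ic) ?mul0rn ?mulr0n.
  have [->|] := eqVneq i j; last by rewrite !mulr0n oppr0 mulr1n addr0.
  rewrite !mulr1n opprK.
  (* After alignment of exponents, the two [f] terms carry the factors [m] and [m'], which add up to
     [m + m']; the [g] term occurs once on each side. *)
  have -> : k - (2 * (m + m') - 1) = k - (2 * m' + 1) - (2 * m - 2) by ring.
  have -> : k - 2 * m - (2 * m' - 1) = k - (2 * m' + 1) - (2 * m - 2) by ring.
  have -> : k - 2 * m - (2 * m' + 1) = k - (2 * (m + m') + 1) by ring.
  by rewrite intrD mulrDl addrA.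
have ee i m j m' : leib (e_loop i m) (e_loop j m').
  rewrite /leib loop_br_ee D0; apply: twval_inj; apply: laurent_coord_eq => c k.
    by rewrite twval0 mcoeff0 linear0 twvalD mcoeffD linearD /= !xi_loop_br addr0.
  rewrite twval0 mcoeff0 linear0 twvalD mcoeffD linearD /= (loop_brC (D _)).
  rewrite twvalN mcoeffN linearN /=.
  rewrite !eta_e_loop_br.
  have [_ _ -> _] := phiN i m c (k - (2 * m' + 1)).
  have [_ _ -> _] := phiN j m' c (k - (2 * m + 1)).
  by rewrite !oppr0 !mul0rn oppr0 addr0.
have hy i m y : leib (h_loop i m) y.
  apply: (leibC); apply: (gen (h_loop i m)) => j m'; first exact: hh.
  by apply: (leibC); exact: he.
have ey i m y : leib (e_loop i m) y.
  by apply: (leibC); apply: (gen (e_loop i m)) => j m'; [exact: he | exact: ee].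
by move=> x y; exact: (gen y (fun i m => hy i m y) (fun i m => ey i m y) x).
Qed.


(** * Normal form of a derivation of the loop algebra *)

Section DerivationCoords.
Variable D : Lbar -> Lbar.
Hypothesis derD : derivation lbr D.

Let DL := proj1 derD.
Let Dbr x y : D (lbr x y) = lbr (D x) y + lbr x (D y).
Proof. exact: (proj2 derD). Qed.

(** Leibniz rule for [e_j t^(2m+1) = [h_j, e_j t^(2m+1)]]. It confines [D (e_loop j m)] to the [e_j]
    direction. *)
Lemma der_e_loop j m : D (e_loop j m) =
  lbr (D (h_loop j 0)) (e_loop j m) + lbr (h_loop j 0) (D (e_loop j m)).
Proof. by rewrite -Dbr loop_br_he eqxx add0r. Qed.

Lemma xi_der_e c j m k : xi c (D (e_loop j m))~_k = 0.
Proof. by rewrite der_e_loop twvalD mcoeffD linearD /= !xi_loop_br addr0. Qed.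

Lemma eta_der_e_neq c j m k : j != c -> eta c (D (e_loop j m))~_k = 0.
Proof.
move=> jc; rewrite der_e_loop twvalD mcoeffD linearD /= (loop_brC (D _)).
rewrite twvalN mcoeffN linearN /= eta_e_loop_br eta_h_loop_br (negPf jc).
by rewrite !mulr0n oppr0 addr0.
Qed.

(* The Leibniz rule for the bracket of [h_i t^(2m)] and [e_j t^(2m'+1)]. *)
Lemma eta_der_he i j m m' k :
  eta j (D (e_loop j (m + m')))~_k *+ (i == j) =
  xi j (D (h_loop i m))~_(k - (2 * m' + 1)) +
  eta j (D (e_loop j m'))~_(k - 2 * m) *+ (i == j).
Proof.
have := congr1 (fun x => eta j x~_k) (Dbr (h_loop i m) (e_loop j m')).
rewrite loop_br_he (linMn DL) twvalMn mcoeffMn linearMn twvalD mcoeffD linearD /= => ->.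
rewrite (loop_brC (D _)) twvalN mcoeffN linearN /=.
by rewrite eta_e_loop_br eta_h_loop_br eqxx mulr1n opprK.
Qed.

(** For [i != c] only one term of [eta_der_he] remains; [k + 1] compensates the degree 1 of
    [e_c t]. *)
Lemma xi_der_h_neq c i m k : i != c -> xi c (D (h_loop i m))~_k = 0.
Proof.
move=> ic; have := eta_der_he i c m 0 (k + 1).
rewrite (negPf ic) !mulr0n addr0 mulr0 add0r.
by rewrite (_ : k + 1 - 1 = k) => [<-//|]; ring.
Qed.

(** Leibniz rule for [[h_i t^(2m), h_j t^(2m')] = 0]. *)
Lemma eta_der_hh c i j m m' k :
  eta c (D (h_loop i m))~_(k - 2 * m') *+ (j == c) =
  eta c (D (h_loop j m'))~_(k - 2 * m) *+ (i == c).
Proof.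
have := congr1 (fun x => eta c x~_k) (Dbr (h_loop i m) (h_loop j m')).
rewrite loop_br_hh (lin0 DL) twval0 mcoeff0 linear0 twvalD mcoeffD linearD /=.
rewrite (loop_brC (D _)) twvalN mcoeffN linearN /= !eta_h_loop_br addrC => /esym/eqP.
by rewrite subr_eq0 => /eqP.
Qed.

Lemma eta_der_h c i m k :
  eta c (D (h_loop i m))~_k = eta i (D (h_loop i 0))~_(k - 2 * m) *+ (i == c).
Proof.
have := eta_der_hh c i c m 0 k; rewrite eqxx mulr1n mulr0 subr0 => ->.
by have [->|] := eqVneq i c.
Qed.

(* The [h_i]-coordinate of [D (h_i r)] is a derivation of [R] in [r]. *)
Lemma xi_der_hD i m m' k : xi i (D (h_loop i (m + m')))~_k =
  xi i (D (h_loop i m))~_(k - 2 * m') + xi i (D (h_loop i m'))~_(k - 2 * m).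
Proof.
(* The image of [e_i t^(2(m+m')+1)] is computed from [e_i t] in one step and in two steps; the [eta]
   coordinates cancel in the comparison. *)
have e1 := eta_der_he i i m m' (k + 1); have e2 := eta_der_he i i (m + m') 0 (k + 1).
have e3 := eta_der_he i i m' 0 (k - 2 * m + 1); move: e1 e2 e3.
rewrite eqxx !mulr1n mulr0 add0r !addr0.
have -> : k + 1 - 1 = k by ring.
have -> : k + 1 - (2 * m' + 1) = k - 2 * m' by ring.
have -> : k - 2 * m + 1 - 1 = k - 2 * m by ring.
have -> : k + 1 - 2 * m = k - 2 * m + 1 by ring.
have -> : k - 2 * m + 1 - 2 * m' = k + 1 - 2 * (m + m') by ring.
by move=> -> /[swap] ->; rewrite addrA => /addIr.
Qed.

Lemma xi_der_h i m k : xi i (D (h_loop i m))~_k =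
  m%:~R * xi i (D (h_loop i 1))~_(k - (2 * m - 2)).
Proof.
(* The degree moves along with [m'], so [xi_der_hD] says that [a] is additive; an additive map on
   [int] is determined by its value at 1. *)
pose a m' := xi i (D (h_loop i m'))~_(k - 2 * m + 2 * m').
have aD m1 m2 : a (m1 + m2) = a m1 + a m2.
  rewrite /a xi_der_hD.
  have -> : k - 2 * m + 2 * (m1 + m2) - 2 * m2 = k - 2 * m + 2 * m1 by ring.
  by have -> : k - 2 * m + 2 * (m1 + m2) - 2 * m1 = k - 2 * m + 2 * m2 by ring.
have a0 : a 0 = 0 by apply: (addrI (a 0)); rewrite -aD !addr0.
have aN m1 : a (- m1) = - a m1.
  by apply/eqP; rewrite -addr_eq0 -aD addNr a0.
have an (p : nat) : a p = p%:R * a 1.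
  elim: p => [|p IHp]; first by rewrite a0 mul0r.
  by rewrite -addn1 PoszD aD IHp natrD mulrDl mul1r.
have aE (p : int) : a p = p%:~R * a 1.
  by case: p => p; rewrite ?NegzE ?aN an // mulrNz mulNr.
have -> : xi i (D (h_loop i m))~_k = a m by rewrite /a subrK.
by rewrite aE /a; have -> : k - 2 * m + 2 * 1 = k - (2 * m - 2) by ring.
Qed.

Lemma derivation_normal_form : exists f g b : 'I_n -> laurent F^o,
  [/\ forall i, f i \in in_R, forall i, g i \in in_R, forall i, b i \in in_Rt &
      normal_form f g b (twval \o D)].
Proof.
(* The witnesses are coordinates of [D (h_i t^2)], of [D (e_i t)] divided by [t], and of
   [D (h_i)]. *)
exists (fun i => laurent_map (xi i) (twval (D (h_loop i 1)))),
  (fun i => lmul (laurent_map (eta i) (twval (D (e_loop i 0)))) (lX F (- 1))),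
  (fun i => laurent_map (eta i) (twval (D (h_loop i 0)))).
split=> [i|i|i|i m c k].
- by apply/in_RP => m; rewrite laurent_mapE xi_odd.
- apply/in_RP => m; rewrite lmulXE laurent_mapE.
  by rewrite (_ : 2 * m + 1 - -1 = 2 * (m + 1)) ?eta_even //; ring.
- by apply/in_RtP => m; rewrite laurent_mapE eta_even.
rewrite !lmulXE !laurent_mapE /=; split.
- have [<-|ic] := eqVneq i c; last by rewrite xi_der_h_neq.
  exact: xi_der_h.
- exact: eta_der_h.
- exact: xi_der_e.
have [<-|ic] := eqVneq i c; last by rewrite eta_der_e_neq.
have := eta_der_he i i m 0 k; rewrite eqxx !mulr1n addr0 mulr0 add0r => ->.
rewrite (xi_der_h i m).
have -> : k - 1 - (2 * m - 2) = k - (2 * m - 1) by ring.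
by have -> : k - (2 * m + 1) - -1 = k - 2 * m by ring.
Qed.

End DerivationCoords.

(** * Almost inner derivations *)

Lemma almost_inner_inner D : almost_inner lbr D -> inner lbr D.
Proof.
case=> derD aD; have [f [g [b [_ gR bR DN]]]] := derivation_normal_form derD.
(* The minus sign compensates [[e_i, h_i] = - e_i]. *)
pose a := \sum_i (tens (h i) (g i) - tens (e i) (b i)).
have xi_a c k : xi c a@_k = (g c)@_k.
  rewrite /a (raddf_sum (mcoeff k)) linear_sum (bigD1 c) //= big1 => [|i ic].
    rewrite mcoeffB !tensE linearB !linearZ /= (xi_h frV coV) (xi_e frV coV) eqxx.
    by rewrite oppr0 scaler0 !addr0 [_ *: _]mulr1.
  rewrite mcoeffB !tensE linearB !linearZ /= (xi_h frV coV) (xi_e frV coV) eq_sym.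
  by rewrite (negPf ic) mulr0n oppr0 !scaler0 addr0.
have eta_a c k : eta c a@_k = - (b c)@_k.
  rewrite /a (raddf_sum (mcoeff k)) linear_sum (bigD1 c) //= big1 => [|i ic].
    rewrite mcoeffB !tensE linearB !linearZ /= (eta_h frV coV) (eta_e frV coV) eqxx.
    by rewrite scaler0 add0r addr0 scalerN [_ *: _]mulr1.
  rewrite mcoeffB !tensE linearB !linearZ /= (eta_h frV coV) (eta_e frV coV) eq_sym.
  by rewrite (negPf ic) mulr0n oppr0 !scaler0 addr0.
have a_tw : a \in twisted A0 A1.
  apply/twisted_coords => i m; rewrite xi_a eta_a.
  split; first by rewrite (proj1 (in_RtP _) (bR i)) oppr0.
  by rewrite (proj1 (in_RP _) (gR i)).
(* The series [f i] is the [xi] coordinate of [D (h_i t^2)], which is a bracket, and [xi] kills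
   brackets. *)
have f0 i k : (f i)@_k = 0.
  have [y yE] := aD (h_loop i 1); have [+ _ _ _] := DN i 1 i k.
  by rewrite /= yE xi_loop_br eqxx mulr1 subrr subr0 mul1r mulr1n => <-.
exists (TwLoop a_tw) => x; apply: twval_inj; move: x.
apply: (normal_form_eq (f := f) (g := g) (b := b)) => //.
- by move=> c x y; rewrite /= (proj1 derD) twvalD twvalZ.
- by move=> c x y; rewrite /= loop_br_linearr twvalD twvalZ.
move=> i m c k; rewrite !f0 !mulr0 mul0rn add0r; split.
- exact: xi_loop_br.
- rewrite loop_brC twvalN mcoeffN linearN /= eta_h_loop_br eta_a.
  by case: eqP => [->|_]; rewrite ?mulr0n ?oppr0 // opprK.
- exact: xi_loop_br.
rewrite loop_brC twvalN mcoeffN linearN /= eta_e_loop_br xi_a.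
by case: eqP => [->|_]; rewrite ?mulr0n ?oppr0 // opprK.
Qed.

End LoopFrame.

(** * Tensor decomposition *)

Section LaurentExtension.
Variables (F : fieldType) (V W : lmodType F) (G : int -> V -> W).
Hypothesis GL : forall k, linear (G k).

Lemma laurent_ext_linear : linear (fun u : laurent V => \sum_(k <- msupp u) G k u@_k).
Proof.
have GD k : {morph G k : a b / a + b} by exact: linD (GL k).
move=> c u v; rewrite (laurent_extD GD); congr (_ + _).
rewrite (laurent_ext_sum GD (erefl (c *: u))) scaler_sumr.
by apply: eq_bigr => k _; rewrite (linZ (GL k)).
Qed.

End LaurentExtension.

Section TensorZero.
Variables (F : fieldType) (U W : lmodType F) (A : U -> Prop) (B : W -> Prop).

Definition linear_closed_pred (M : lmodType F) (P : M -> Prop) : Prop :=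
  P 0 /\ forall c u v, P u -> P v -> P (c *: u + v).

Lemma linear_closed_sum (M : lmodType F) (P : M -> Prop) (I : eqType) (r : seq I)
    (c : I -> F) (v : I -> M) :
  linear_closed_pred P -> (forall i, i \in r -> P (v i)) ->
  P (\sum_(i <- r) c i *: v i).
Proof.
move=> [P0 PD] Pv; elim: r Pv => [|i r IHr] Pv; first by rewrite big_nil.
rewrite big_cons; apply: PD; first by apply: Pv; rewrite mem_head.
by apply: IHr => j jr; apply: Pv; rewrite inE jr orbT.
Qed.

(** Here [g] is linear only along the subspace [P], so membership of the partial sums in [P] is
    carried through the induction. *)
Lemma linear_on_sum (M Z : lmodType F) (P : M -> Prop) (g : M -> Z) (I : eqType)
    (r : seq I) (c : I -> F) (v : I -> M) : linear_closed_pred P ->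
    (forall a u w, P u -> P w -> g (a *: u + w) = a *: g u + g w) ->
    (forall i, i \in r -> P (v i)) ->
  g (\sum_(i <- r) c i *: v i) = \sum_(i <- r) c i *: g (v i).
Proof.
move=> PC gL; have [P0 _] := PC.
(* Linearity at 0 with coefficient -1 reads [g 0 = - g 0 + g 0]. *)
have g0 : g 0 = 0.
  by have := gL (-1) 0 0 P0 P0; rewrite scaler0 addr0 scaleN1r addNr.
elim: r => [|i r IHr] Pv; first by rewrite !big_nil.
have Pr j : j \in r -> P (v j) by move=> jr; apply: Pv; rewrite inE jr orbT.
rewrite !big_cons gL ?IHr //; first by apply: Pv; rewrite mem_head.
exact: linear_closed_sum.
Qed.

(** Expanding the first factors along [b] and collecting the second ones rewrites the sum as that of
    [phi (b i)] applied to the combinations assumed to vanish. *)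
Lemma tensor_zero_basis n (b : 'I_n -> U) (c : 'I_n -> U -> F) s :
    linear_closed_pred A -> linear_closed_pred B ->
    (forall i, A (b i)) -> (forall u, A u -> u = \sum_i c i u *: b i) ->
    tensor_sum A B s -> (forall i, \sum_(p <- s) c i p.1 *: p.2 = 0) ->
  tensor_zero A B s.
Proof.
move=> AC BC Ab Ac sAB s0 Z phi [phil phir]; have [B0 _] := BC.
transitivity (\sum_(p <- s) \sum_i c i p.1 *: phi (b i) p.2).
  apply: eq_big_seq => p /sAB[Ap Bp]; rewrite {1}(Ac _ Ap).
  apply: (linear_on_sum (P := A) (g := phi^~ p.2)) => // a u w Au Aw.
  exact: phil.
rewrite exchange_big big1 // => i _.
rewrite -(linear_on_sum (P := B) (g := phi (b i))) ?s0 //; last by move=> p /sAB[].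
  by have := phir (-1) _ _ _ (Ab i) B0 B0; rewrite scaler0 addr0 scaleN1r addNr.
by move=> a u w Bu Bw; exact: phir.
Qed.

End TensorZero.

(** * The derivations of the even Laurent polynomials *)

Section EvenLaurent.
Variable F : fieldType.
Implicit Types (f g : laurent F^o) (s : evenLaurent F).

Lemma lmulC f g : lmul f g = lmul g f.
Proof.
rewrite /lmul exchange_big; apply: eq_bigr => j _; apply: eq_bigr => i _.
by rewrite mulrC addrC.
Qed.

Lemma lmul_lXE f k m : (lmul (lX F k) f)@_m = f@_(m - k : int).
Proof. by rewrite lmulC lmulXE. Qed.

Lemma lmul_lX0 k : lmul (lX F k) 0 = 0.
Proof. by apply/malgP => m; rewrite lmul_lXE !mcoeff0. Qed.

Lemma lmul_lXP k (c : F) f g :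
  lmul (lX F k) (c *: f + g) = c *: lmul (lX F k) f + lmul (lX F k) g.
Proof.
apply/malgP => m; rewrite lmul_lXE [RHS]mcoeffD [X in _ = X + _]lcoeffZ.
by rewrite !lmul_lXE mcoeffD lcoeffZ.
Qed.

Lemma evenLaurent_decomp s :
  s = \sum_(k <- msupp (twval s)) ((twval s)@_k : F) *: lX2 F (k %/ 2)%Z.
Proof.
apply: twval_inj; rewrite twval_sum [in LHS](monalgE (twval s)).
apply: eq_big_seq => k ks; rewrite twvalZ /=.
have -> : 2 * (k %/ 2)%Z = k.
  have [m [->|km]] := even_or_odd k; first by lia.
  by move: ks; rewrite -mcoeff_neq0 km (proj1 (in_RP _) (valP s)) eqxx.
by apply/malgP => m; rewrite lcoeffZ !mcoeffU -scalerMnr [_ *: 1]mulr1.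
Qed.

(** For [j = 1] the defining formula gives [delta (t^2) = f], so [f] can be replaced by that
    value. *)
Lemma Der_S_coeff (delta : evenLaurent F -> evenLaurent F) j m : Der_S delta ->
  (twval (delta (lX2 F j)))@_m =
  j%:~R * (twval (delta (lX2 F 1)))@_(m - (2 * j - 2)).
Proof.
case=> _ [f fE]; rewrite !fE !lcoeffZ !lmul_lXE.
by rewrite mulr1 subrr subr0 [1%:~R *: _]mul1r.
Qed.

Lemma Der_S_eq0 (delta : evenLaurent F -> evenLaurent F) : Der_S delta ->
  twval (delta (lX2 F 1)) = 0 -> delta = 0.
Proof.
move=> dS d0; apply/funext => s; rewrite [s]evenLaurent_decomp (lin_sum (proj1 dS)).
rewrite big1 // => k _; rewrite (linZ (proj1 dS)); move: (k %/ 2)%Z => j.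
rewrite (_ : delta (lX2 F j) = 0) ?scaler0 //; apply: twval_inj; apply/malgP => m.
by rewrite (Der_S_coeff j m dS) d0 !mcoeff0 mulr0.
Qed.

Lemma Der_S_exists f : f \in in_R ->
  exists delta : evenLaurent F -> evenLaurent F,
    Der_S delta /\ twval (delta (lX2 F 1)) = f.
Proof.
(* Only even [k] occur in the support of an element of R, where [k %/ 2] is exact. *)
move=> fR; pose G (k : int) (a : F^o) : laurent F^o :=
  (a * (k %/ 2)%Z%:~R) *: lmul (lX F (2 * (k %/ 2)%Z - 2)) f.
have GL k : linear (G k).
  by move=> c a b; rewrite /G scalerA -scalerDl mulrDl -mulrA.
have GR (s : evenLaurent F) :
    \sum_(k <- msupp (twval s)) G k (twval s)@_k \in in_R.
  apply: rpred_sum => k _; apply: rpredZ; apply/in_RP => m.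
  rewrite lmul_lXE (_ : _ - _ = 2 * (m - (k %/ 2)%Z + 1) + 1); last by ring.
  exact: (proj1 (in_RP f)).
pose delta s := TwLoop (GR s).
have dE j : twval (delta (lX2 F j)) = (j%:~R : F) *: lmul (lX F (2 * j - 2)) f.
  rewrite /= (laurent_extU (fun k => linD (GL k))) /G mul1r.
  by have -> : (2 * j %/ 2)%Z = j by lia.
have lX0 : lmul (lX F (2 * 1 - 2)) f = f.
  by apply/malgP => m; rewrite lmul_lXE mulr1 subrr subr0.
exists delta; split; last by rewrite dE lX0 scale1r.
split; last by exists (TwLoop fR) => j; rewrite dE.
move=> c s s'; apply: twval_inj; rewrite twvalD twvalZ.
exact: (laurent_ext_linear GL).
Qed.

Lemma Der_S_closed : linear_closed_pred (@Der_S F).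
Proof.
have Der_SP (delta : evenLaurent F -> evenLaurent F) (f : evenLaurent F) :
    linear delta -> (forall j, twval (delta (lX2 F j)) =
      (j%:~R : F) *: lmul (lX F (2 * j - 2)) (twval f)) -> Der_S delta.
  by move=> dL dE; split=> //; exists f.
split=> [|c d d' [dL [f fE]] [dL' [f' fE']]].
  apply: (Der_SP _ 0) => [a x y|j]; first by rewrite scaler0 addr0.
  by rewrite twval0 lmul_lX0 scaler0.
apply: (Der_SP _ (c *: f + f')) => [a x y|j].
  rewrite -[LHS]/(c *: d (a *: x + y) + d' (a *: x + y)) dL dL'.
  rewrite -[in RHS]/(a *: (c *: d x + d' x) + (c *: d y + d' y)).
  by rewrite !scalerDr !scalerA [c * a]mulrC addrACA.
rewrite -[LHS]/(twval (c *: d (lX2 F j) + d' (lX2 F j))) !twvalD !twvalZ fE fE'.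
by rewrite lmul_lXP scalerDr !scalerA mulrC.
Qed.

Lemma in_R_closed : linear_closed_pred (fun r : laurent F^o => r \in in_R).
Proof. by split=> [|c u v uR vR]; rewrite ?rpred0 // rpredD ?rpredZ. Qed.

Lemma in_Rt_closed : linear_closed_pred (fun r : laurent F^o => r \in in_Rt).
Proof. by split=> [|c u v uR vR]; rewrite ?rpred0 // rpredD ?rpredZ. Qed.

End EvenLaurent.

(** * Derivations and centroid of the frame algebra, and their action on loops *)

Section LoopAct.
Variables (F : fieldType) (V : vectType F) (br : V -> V -> V).
Variables (A0 A1 : {vspace V}) (n : nat) (h e : 'I_n -> V).
Variables xi eta : 'I_n -> {linear V -> F^o}.
Hypotheses (lieV : lie_bracket br) (frV : borel_frame br A0 A1 h e).
Hypothesis coV : frame_coords br h e xi eta.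

Local Notation Lbar := (twloop A0 A1).
Local Notation Der k := (fun d : 'End(V) => graded_derivation br (lie_gr A0 A1) k d).
Local Notation Cent := (fun lam : 'End(V) => centroid br lam).
Local Notation R := (fun r : laurent F^o => r \in in_R).
Local Notation Rt := (fun r : laurent F^o => r \in in_Rt).
Implicit Types (d lam : 'End(V)) (i j c : 'I_n).

(** Leibniz rule for [[h i, e j]]. *)
Lemma der_he d i j : derivation br d ->
  d (e j) *+ (i == j) = xi j (d (h i)) *: e j + eta i (d (e j)) *: e i.
Proof.
case=> _ dbr; rewrite -(xiE coV) -(etaE coV) -dbr (frame_he frV).
by rewrite linearMn.
Qed.

(** The [e i] coordinate of [der_he] for [i = j] has the same term on both sides, which leaves
    [xi i (d (h i)) = 0]. *)
Lemma der_e d i : derivation br d ->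
  d (e i) = eta i (d (e i)) *: e i /\ xi i (d (h i)) = 0.
Proof.
move=> dd; have := der_he i i dd; rewrite eqxx mulr1n => dE.
suff x0 : xi i (d (h i)) = 0 by rewrite x0 scale0r add0r in dE.
have := congr1 (eta i) dE; rewrite linearD !linearZ /= (eta_e frV coV) eqxx.
by rewrite ![_ *: 1]mulr1 => /eqP; rewrite -subr_eq subrr eq_sym => /eqP.
Qed.

Lemma der_xi_h d i j : derivation br d -> xi j (d (h i)) = 0.
Proof.
move=> dd; have [<-|ij] := eqVneq i j; first by case: (der_e i dd).
have := der_he i j dd; rewrite (negPf ij) mulr0n (proj1 (der_e j dd)) linearZ /=.
rewrite (eta_e frV coV) (negPf ij) scaler0 scale0r addr0 => /esym/eqP.
by rewrite scaler_eq0 (negPf (frame_neq0 frV j)) orbF => /eqP.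
Qed.

(** Take the [e j] coordinate of [d] applied to [[h j, h i] = 0]. *)
Lemma der_eta_h d i j : derivation br d -> i != j -> eta j (d (h i)) = 0.
Proof.
move=> [dL dbr] ij; have := dbr (h j) (h i).
rewrite (frame_hh frV) linear0 (lieC lieV (d _)) !(etaE coV).
move/(congr1 (eta j)); rewrite linear0 linearD linearN !linearZ /= !(eta_e frV coV).
by rewrite eqxx eq_sym (negPf ij) mulr0n oppr0 scaler0 add0r [_ *: _]mulr1.
Qed.

Lemma der_h d i : derivation br d -> d (h i) = eta i (d (h i)) *: e i.
Proof.
move=> dd; rewrite [LHS](coordE coV) big1 => [|j _]; last by rewrite der_xi_h ?scale0r.
rewrite add0r (bigD1 i) //= big1 ?addr0 // => j ji.
by rewrite der_eta_h ?scale0r // eq_sym.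
Qed.

Lemma der0_h d i : Der false d -> d (h i) = 0.
Proof.
case=> dd gr; rewrite der_h // (proj1 (memA0 frV coV _)) ?scale0r //.
exact: (gr false) (frame_h_in frV i).
Qed.

Lemma der1_e d i : Der true d -> d (e i) = 0.
Proof.
case=> dd gr; rewrite (proj1 (der_e i dd)) (proj1 (memA0 frV coV _)) ?scale0r //.
exact: (gr true) (frame_e_in frV i).
Qed.

Lemma cent_he lam i j : centroid br lam ->
  xi j (lam (h i)) *: e j = lam (e j) *+ (i == j).
Proof.
by case=> _ lbr; rewrite -(xiE coV) -(proj1 (lbr _ _)) (frame_he frV) linearMn.
Qed.

Lemma cent_e lam i : centroid br lam -> lam (e i) = xi i (lam (h i)) *: e i.
Proof. by move=> lc; rewrite cent_he // eqxx. Qed.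

(** The other [xi] coordinates vanish by [cent_he]; the [eta j] vanish because [[h j, lam (h i)] =
    lam [h j, h i] = 0]. *)
Lemma cent_h lam i : centroid br lam -> lam (h i) = xi i (lam (h i)) *: h i.
Proof.
move=> lc; rewrite [LHS](coordE coV) [X in _ + X]big1 => [|j _].
  rewrite addr0 (bigD1 i) //= big1 ?addr0 // => j ji.
  apply/eqP; rewrite scaler_eq0 -[_ == 0]orbF -(negPf (frame_neq0 frV j)) -scaler_eq0.
  by rewrite cent_he // [i == j]eq_sym (negPf ji) mulr0n eqxx.
rewrite -(etaE coV); case: lc => _ /(_ (h j) (h i))[_ <-].
by rewrite (frame_hh frV) linear0.
Qed.

Lemma mem_lie_gr (b : bool) x : (x \in lie_gr A0 A1 b) = (x \in if b then A1 else A0).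
Proof. by []. Qed.

Lemma graded_derivation_closed k : linear_closed_pred (Der k).
Proof.
split=> [|c d d' [[dL dbr] dgr] [[dL' dbr'] dgr']].
  split; last by move=> i x _; rewrite zero_lfunE mem_lie_gr; case: ifP; rewrite mem0v.
  split=> [|x y]; first exact: linearP.
  by rewrite !zero_lfunE (lie0l lieV) (lie0r lieV) addr0.
split; last first.
  move=> i x xi'; rewrite add_lfunE scale_lfunE.
  have := dgr i x xi'; have := dgr' i x xi'; rewrite !mem_lie_gr => ? ?.
  by rewrite rpredD ?rpredZ.
split=> [|x y]; first exact: linearP.
rewrite !add_lfunE !scale_lfunE dbr dbr' !(lieDl lieV) !(lieDr lieV).
by rewrite (lieZl lieV) (lieZr lieV) scalerDr addrACA.
Qed.

Lemma centroid_closed : linear_closed_pred Cent.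
Proof.
split=> [|c d d' [dL dbr] [dL' dbr']].
  by split=> [|x y]; [exact: linearP | rewrite !zero_lfunE (lie0l lieV) (lie0r lieV)].
split=> [|x y]; first exact: linearP.
rewrite !add_lfunE !scale_lfunE (lieDl lieV) (lieDr lieV) (lieZl lieV) (lieZr lieV).
have [d1 d2] := dbr x y; have [d1' d2'] := dbr' x y.
by split; [rewrite d1 d1' | rewrite d2 d2'].
Qed.

Fact der_act_term_linear d r k : linear (fun a : V => tens (d a) (lmul r (lX F k))).
Proof.
move=> c a b; apply/malgP => m.
by rewrite [RHS]mcoeffD [X in _ = X + _]lcoeffZ !tensE linearP scalerDr !scalerA mulrC.
Qed.

Lemma der_act_linear d r : linear (@der_act F V d r).
Proof. exact: laurent_ext_linear (der_act_term_linear d r). Qed.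

Lemma der_actUE d r a k m : (der_act d r << a *g k >>)@_m = r@_(m - k) *: d a.
Proof.
rewrite /der_act (laurent_extU (fun k => linD (der_act_term_linear d r k))).
by rewrite tensE lmulXE.
Qed.

Fact cent_act_term_linear lam (delta : evenLaurent F -> evenLaurent F) k :
  linear (fun a : V => tens (lam a)
    (lmul (twval (delta (lX2 F (k %/ 2)%Z))) (lX F (k %% 2)%Z))).
Proof.
move=> c a b; apply/malgP => m.
by rewrite [RHS]mcoeffD [X in _ = X + _]lcoeffZ !tensE linearP scalerDr !scalerA mulrC.
Qed.

Lemma cent_act_linear lam (delta : evenLaurent F -> evenLaurent F) :
  linear (@cent_act F V lam delta).
Proof. exact: laurent_ext_linear (cent_act_term_linear lam delta). Qed.

Lemma cent_actUE lam (delta : evenLaurent F -> evenLaurent F) a (j : int) (b : bool) m :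
    Der_S delta ->
  (cent_act lam delta << a *g 2 * j + (b : nat)%:Z >>)@_m =
  (j%:~R * (twval (delta (lX2 F 1)))@_(m - (b : nat)%:Z - (2 * j - 2))) *: lam a.
Proof.
move=> dS; rewrite /cent_act.
rewrite (laurent_extU (fun k => linD (cent_act_term_linear lam delta k))) tensE lmulXE.
have -> : ((2 * j + (b : nat)%:Z) %/ 2)%Z = j by case: b; lia.
have -> : ((2 * j + (b : nat)%:Z) %% 2)%Z = b by case: b; lia.
by rewrite (Der_S_coeff _ _ dS).
Qed.

Lemma loop_act_linear s0 s1 s2 : linear (@loop_act F V s0 s1 s2).
Proof.
have sumL (T : Type) (s : seq T) (phi : T -> laurent V -> laurent V) :
    (forall p, linear (phi p)) -> linear (fun u => \sum_(p <- s) phi p u).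
  move=> phiL c u v; rewrite scaler_sumr -big_split; apply: eq_bigr => p _ /=.
  exact: phiL.
have L0 := sumL _ s0 _ (fun p => der_act_linear p.1 p.2).
have L1 := sumL _ s1 _ (fun p => der_act_linear p.1 p.2).
have L2 := sumL _ s2 _ (fun p => cent_act_linear p.1 p.2).
move=> c u v; rewrite /loop_act L0 L1 L2 !scalerDr.
by rewrite [RHS]addrACA; congr (_ + _); exact: addrACA.
Qed.

(** The three symbols contract each first factor with its [i]-th coordinate. They are the series
    [g i], [b i] and [f i] of the normal form, and they detect vanishing both of the tensor and of
    the operator. *)
Definition even_symbol (s : seq ('End(V) * laurent F^o)) i : laurent F^o :=
  \sum_(p <- s) (eta i (p.1 (e i)) : F) *: p.2.
Definition odd_symbol (s : seq ('End(V) * laurent F^o)) i : laurent F^o :=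
  \sum_(p <- s) (eta i (p.1 (h i)) : F) *: p.2.
Definition cent_symbol (s : seq ('End(V) * (evenLaurent F -> evenLaurent F))) i :
  laurent F^o := \sum_(p <- s) (xi i (p.1 (h i)) : F) *: twval (p.2 (lX2 F 1)).

(** Collects a sum over tensors into a symbol; [b] is the common factor, [m] or 1, and [q] is a
    Kronecker delta. *)
Lemma coord_sum (T : eqType) (s : seq T) (phi : T -> laurent V) (f : {linear V -> F^o})
    (r : T -> laurent F^o) (a : T -> F) (b : F) q k k' :
    (forall p, p \in s -> f (phi p)@_k = (b * (a p * (r p)@_k') *+ q : F)) ->
  f (\sum_(p <- s) phi p)@_k = b * (\sum_(p <- s) a p *: r p)@_k' *+ q.
Proof.
move=> fE; rewrite !(raddf_sum (mcoeff _)) linear_sum mulr_sumr -sumrMnl.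
by apply: eq_big_seq => p ps; rewrite fE //= lcoeffZ.
Qed.

(** Even derivations kill the [h i], odd ones kill the [e i] and send [h i] to a multiple of [e i],
    and the centroid scales both, so the symbols enter the coordinates separately. *)
Lemma loop_act_normal s0 s1 s2 :
    tensor_sum (Der false) R s0 -> tensor_sum (Der true) Rt s1 ->
    tensor_sum Cent (@Der_S F) s2 ->
  normal_form xi eta frV (cent_symbol s2) (even_symbol s0) (odd_symbol s1)
    (fun x : Lbar => loop_act s0 s1 s2 (twval x)).
Proof.
move=> t0 t1 t2 i m c k.
have coord0 (T : eqType) (s : seq T) (phi : T -> laurent V) (f : {linear V -> F^o}) k' :
    (forall p, p \in s -> f (phi p)@_k' = 0) -> f (\sum_(p <- s) phi p)@_k' = 0.
  by move=> f0; rewrite (raddf_sum (mcoeff _)) linear_sum big1_seq // => p /andP[_ /f0].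
have h0 p k' : p \in s0 -> (der_act p.1 p.2 << h i *g 2 * m >>)@_k' = 0.
  by move=> /t0[dp _]; rewrite der_actUE der0_h ?scaler0.
have e1 p k' : p \in s1 -> (der_act p.1 p.2 << e i *g 2 * m + 1 >>)@_k' = 0.
  by move=> /t1[dp _]; rewrite der_actUE der1_e ?scaler0.
have h1 p k' : p \in s1 -> (der_act p.1 p.2 << h i *g 2 * m >>)@_k' =
    p.2@_(k' - 2 * m) *: (eta i (p.1 (h i)) *: e i).
  by move=> /t1[/= [dp _] _]; rewrite der_actUE {1}der_h.
have h2 p k' : p \in s2 -> (cent_act p.1 p.2 << h i *g 2 * m >>)@_k' =
    (m%:~R * (twval (p.2 (lX2 F 1)))@_(k' - (2 * m - 2))) *: (xi i (p.1 (h i)) *: h i).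
  move=> /t2[/= lp dp]; have := cent_actUE p.1 (h i) m false k' dp.
  by rewrite addr0 subr0 {1}cent_h.
have e0 p k' : p \in s0 -> (der_act p.1 p.2 << e i *g 2 * m + 1 >>)@_k' =
    p.2@_(k' - (2 * m + 1)) *: (eta i (p.1 (e i)) *: e i).
  by move=> /t0[/= [dp _] _]; rewrite der_actUE {1}(proj1 (der_e i dp)).
have e2 p k' : p \in s2 -> (cent_act p.1 p.2 << e i *g 2 * m + 1 >>)@_k' =
    (m%:~R * (twval (p.2 (lX2 F 1)))@_(k' - (2 * m - 1))) *: (xi i (p.1 (h i)) *: e i).
  move=> /t2[/= lp dp]; have := cent_actUE p.1 (e i) m true k' dp.
  rewrite {1}cent_e //.
  by have -> : k' - (true : nat)%:Z - (2 * m - 2) = k' - (2 * m - 1) by lia.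
have loopE (f : {linear V -> F^o}) u : f (loop_act s0 s1 s2 u)@_k =
    f (\sum_(p <- s0) der_act p.1 p.2 u)@_k + f (\sum_(p <- s1) der_act p.1 p.2 u)@_k +
    f (\sum_(p <- s2) cent_act p.1 p.2 u)@_k.
  by rewrite /loop_act !mcoeffD !linearD.
have [xh xe eh ee] := And4 (xi_h frV coV c i) (xi_e frV coV c i)
  (eta_h frV coV c i) (eta_e frV coV c i).
split; (rewrite [LHS]/=; apply: (etrans (loopE _ _))).
- rewrite coord0 => [|p /h0->]; last by rewrite linear0.
  rewrite coord0 => [|p /h1->]; last by rewrite !linearZ /= xe !scaler0.
  rewrite !add0r.
  apply: coord_sum => p /h2->; rewrite !linearZ /= xh eq_sym.
  by case: (i == c); rewrite /GRing.scale /=; ring.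
- rewrite coord0 => [|p /h0->]; last by rewrite linear0.
  rewrite [X in _ + X]coord0 => [|p /h2->]; last by rewrite !linearZ /= eh !scaler0.
  rewrite add0r addr0 -[(odd_symbol _ _)@__]mul1r.
  apply: coord_sum => p /h1->; rewrite !linearZ /= ee eq_sym.
  by case: (i == c); rewrite /GRing.scale /=; ring.
- rewrite coord0 => [|p /e0->]; last by rewrite !linearZ /= xe !scaler0.
  rewrite coord0 => [|p /e1->]; last by rewrite linear0.
  by rewrite coord0 => [|p /e2->]; rewrite ?addr0 // !linearZ /= xe !scaler0.
rewrite mulrnDl addrC [X in _ + (_ + X)]coord0 ?addr0 => [|p /e1->]; last first.
  by rewrite linear0.
congr (_ + _).
  apply: coord_sum => p /e2->; rewrite !linearZ /= ee eq_sym.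
  by case: (i == c); rewrite /GRing.scale /=; ring.
rewrite -[(even_symbol _ _)@__]mul1r; apply: coord_sum => p /e0->.
rewrite !linearZ /= ee eq_sym.
by case: (i == c); rewrite /GRing.scale /=; ring.
Qed.

Local Notation lbr := (@loop_br F V br A0 A1).
Let lbrE := twval_loop_br lieV frV coV.

Lemma cent_symbol_in_R s i : cent_symbol s i \in in_R.
Proof. by apply: rpred_sum => p _; apply/rpredZ/(valP (p.2 (lX2 F 1))). Qed.

Lemma even_symbol_in_R i s : tensor_sum (Der false) R s -> even_symbol s i \in in_R.
Proof.
move=> sR; rewrite /even_symbol big_seq.
by apply: rpred_sum => p /sR[_ ?]; apply: rpredZ.
Qed.

Lemma odd_symbol_in_Rt i s : tensor_sum (Der true) Rt s -> odd_symbol s i \in in_Rt.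
Proof.
move=> sR; rewrite /odd_symbol big_seq.
by apply: rpred_sum => p /sR[_ ?]; apply: rpredZ.
Qed.

(** The symbols are read off from the images of [e_i t], [h_i] and [h_i t^2]; at [m = 0] the
    centroid term drops out. *)
Lemma loop_act_eq0 s0 s1 s2 :
    tensor_sum (Der false) R s0 -> tensor_sum (Der true) Rt s1 ->
    tensor_sum Cent (@Der_S F) s2 ->
  (forall x : Lbar, loop_act s0 s1 s2 (twval x) = 0) <->
  [/\ forall i, even_symbol s0 i = 0, forall i, odd_symbol s1 i = 0 &
      forall i, cent_symbol s2 i = 0].
Proof.
move=> t0 t1 t2; have N := loop_act_normal t0 t1 t2; split=> [act0 | [z0 z1 z2] x].
  rewrite (funext act0 : _ = fun=> 0) in N.
  split=> i; apply/malgP => k; rewrite mcoeff0.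
  - have [_ _ _] := N i 0 i (k + (2 * 0 + 1)).
    by rewrite mcoeff0 linear0 eqxx mul0r add0r addrK mulr1n => <-.
  - have [_ + _ _] := N i 0 i k.
    by rewrite mcoeff0 linear0 eqxx mulr0 subr0 mulr1n => <-.
  have [+ _ _ _] := N i 1 i k.
  by rewrite mcoeff0 linear0 eqxx mulr1 subrr subr0 mul1r mulr1n => <-.
have L : linear (fun x : Lbar => loop_act s0 s1 s2 (twval x)).
  by move=> c u v; rewrite twvalD twvalZ; exact: loop_act_linear.
have L0 : linear (fun _ : Lbar => 0 : laurent V) by move=> c u v; rewrite scaler0 addr0.
apply: (normal_form_eq coV L L0 N) => i m c k.
by rewrite z0 z1 z2 !mcoeff0 !linear0 mulr0 addr0 mul0rn.
Qed.

Fact even_basis_linear i : linear (fun v => (eta i v : F) *: e i).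
Proof. by move=> a u v; rewrite linearP scalerDl scalerA. Qed.

Fact odd_basis_linear i : linear (fun v => (xi i v : F) *: e i).
Proof. by move=> a u v; rewrite linearP scalerDl scalerA. Qed.

Fact cent_basis_linear i : linear (fun v => (xi i v : F) *: h i + (eta i v : F) *: e i).
Proof.
move=> a u v; rewrite (linearP (xi i)) (linearP (eta i)).
by rewrite !scalerDl scalerDr !scalerA addrACA.
Qed.

(** These are [ad (h i)], [- ad (e i)] and the projection onto the [i]-th two-dimensional
    summand. *)
Definition even_basis i : 'End(V) := linfun (linear_of (even_basis_linear i)).
Definition odd_basis i : 'End(V) := linfun (linear_of (odd_basis_linear i)).
Definition cent_basis i : 'End(V) := linfun (linear_of (cent_basis_linear i)).

Lemma even_basisE i v : even_basis i v = (eta i v : F) *: e i.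
Proof. by rewrite lfunE. Qed.

Lemma odd_basisE i v : odd_basis i v = (xi i v : F) *: e i.
Proof. by rewrite lfunE. Qed.

Lemma cent_basisE i v : cent_basis i v = (xi i v : F) *: h i + (eta i v : F) *: e i.
Proof. by rewrite lfunE. Qed.

Lemma even_basis_der i : Der false (even_basis i).
Proof.
split.
  split=> [|u v]; first exact: linearP.
  rewrite !even_basisE (lieZl lieV) (lieZr lieV) (lieC lieV (e i)) !(xiE coV).
  rewrite (eta_br lieV frV coV) scalerN !scalerA scalerBl [RHS]addrC.
  by rewrite [eta i v * _]mulrC [eta i u * _]mulrC.
move=> b x; rewrite !mem_lie_gr even_basisE addbF; case: b => [_|xA].
  by rewrite rpredZ ?(frame_e_in frV).
by rewrite (proj1 (memA0 frV coV x) xA) scale0r mem0v.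
Qed.

Lemma odd_basis_der i : Der true (odd_basis i).
Proof.
split.
  split=> [|u v]; first exact: linearP.
  rewrite !odd_basisE (lieZl lieV) (lieZr lieV) (lieC lieV (e i)) !(xiE coV).
  by rewrite (xi_br lieV frV coV) scalerN !scalerA scale0r mulrC addNr.
move=> b x; rewrite !mem_lie_gr odd_basisE; case: b => [xA|_] /=.
  by rewrite (proj1 (memA1 frV coV x) xA) scale0r mem0v.
by rewrite rpredZ ?(frame_e_in frV).
Qed.

Lemma cent_basis_cent i : Cent (cent_basis i).
Proof.
have brl u v : br (cent_basis i u) v = cent_basis i (br u v).
  rewrite !cent_basisE (xi_br lieV frV coV) scale0r add0r (lieDl lieV) !(lieZl lieV).
  rewrite (etaE coV) (lieC lieV (e i)) (xiE coV) (eta_br lieV frV coV).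
  by rewrite scalerN !scalerA -scalerBl [eta i u * _]mulrC.
split=> [|u v]; first exact: linearP.
by rewrite brl (lieC lieV u (cent_basis i v)) brl (lieC lieV v) linearN opprK.
Qed.

Lemma der0_decomp d : Der false d -> d = \sum_i (eta i (d (e i)) : F) *: even_basis i.
Proof.
move=> dd; apply/lfunP => v; rewrite sum_lfunE {1}(coordE coV v) linearD !linear_sum.
rewrite big1 ?add0r => [|i _]; last by rewrite linearZ /= der0_h ?scaler0.
apply: eq_bigr => i _; rewrite linearZ /= {1}(proj1 (der_e i (proj1 dd))).
by rewrite scale_lfunE even_basisE !scalerA mulrC.
Qed.

Lemma der1_decomp d : Der true d -> d = \sum_i (eta i (d (h i)) : F) *: odd_basis i.
Proof.
move=> dd; apply/lfunP => v; rewrite sum_lfunE {1}(coordE coV v) linearD !linear_sum.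
rewrite [X in _ + X]big1 ?addr0 => [|i _].
  apply: eq_bigr => i _; rewrite linearZ /= {1}(der_h i (proj1 dd)).
  by rewrite scale_lfunE odd_basisE !scalerA mulrC.
by rewrite linearZ /= der1_e ?scaler0.
Qed.

Lemma cent_decomp lam : Cent lam -> lam = \sum_i (xi i (lam (h i)) : F) *: cent_basis i.
Proof.
move=> lc; apply/lfunP => v; rewrite sum_lfunE {1}(coordE coV v) linearD !linear_sum.
rewrite -big_split; apply: eq_bigr => i _ /=; rewrite !linearZ /=.
rewrite {1}(cent_h i lc) {1}(cent_e i lc) scale_lfunE cent_basisE.
by rewrite scalerDr !scalerA ![_ * xi i (lam _)]mulrC.
Qed.

(** The symbol is the value of a bilinear map on the tensor, which gives one direction; the other is
    [tensor_zero_basis]. The odd and centroid cases are alike. *)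
Lemma even_tensor_zero s : tensor_sum (Der false) R s ->
  tensor_zero (Der false) R s <-> forall i, even_symbol s i = 0.
Proof.
move=> sD; split=> [z i | z].
  apply: (z _ (fun d r => (eta i (d (e i)) : F) *: r)).
  split=> [c d d' r _ _ _|c d r r' _ _ _].
    by rewrite add_lfunE scale_lfunE linearP scalerDl scalerA.
  by rewrite scalerDr !scalerA mulrC.
apply: (tensor_zero_basis _ _ even_basis_der der0_decomp sD z).
  exact: graded_derivation_closed.
exact: in_R_closed.
Qed.

Lemma odd_tensor_zero s : tensor_sum (Der true) Rt s ->
  tensor_zero (Der true) Rt s <-> forall i, odd_symbol s i = 0.
Proof.
move=> sD; split=> [z i | z].
  apply: (z _ (fun d r => (eta i (d (h i)) : F) *: r)).
  split=> [c d d' r _ _ _|c d r r' _ _ _].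
    by rewrite add_lfunE scale_lfunE linearP scalerDl scalerA.
  by rewrite scalerDr !scalerA mulrC.
apply: (tensor_zero_basis _ _ odd_basis_der der1_decomp sD z).
  exact: graded_derivation_closed.
exact: in_Rt_closed.
Qed.

Lemma cent_tensor_zero s : tensor_sum Cent (@Der_S F) s ->
  tensor_zero Cent (@Der_S F) s <-> forall i, cent_symbol s i = 0.
Proof.
move=> sD; split=> [z i | z].
  apply: (z _ (fun lam delta => (xi i (lam (h i)) : F) *: twval (delta (lX2 F 1)))).
  split=> [c d d' r _ _ _|c d r r' _ _ _].
    by rewrite add_lfunE scale_lfunE linearP scalerDl scalerA.
  rewrite -[X in twval X]/(c *: r (lX2 F 1) + r' (lX2 F 1)) twvalD twvalZ.
  by rewrite scalerDr !scalerA mulrC.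
apply: (tensor_zero_basis _ (@Der_S_closed F) cent_basis_cent cent_decomp sD).
  exact: centroid_closed.
(* An element of [Der_S] is determined by its value at [t^2], which here is the symbol. *)
move=> i; apply: Der_S_eq0.
  by apply: (linear_closed_sum _ (@Der_S_closed F)) => p /sD[].
rewrite -[RHS](z i) /cent_symbol; elim: s {sD z} => [|p s IHs].
  by rewrite !big_nil twval0.
rewrite !big_cons -IHs -twvalZ -twvalD; congr (twval _).
Qed.

Theorem loop_derivations s0 s1 s2 :
    tensor_sum (Der false) R s0 -> tensor_sum (Der true) Rt s1 ->
    tensor_sum Cent (@Der_S F) s2 ->
  exists D : Lbar -> Lbar, derivation lbr D /\
    forall x, twval (D x) = loop_act s0 s1 s2 (twval x).
Proof.
move=> t0 t1 t2.
have L : linear (fun x : Lbar => loop_act s0 s1 s2 (twval x)).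
  by move=> c u v; rewrite twvalD twvalZ; exact: loop_act_linear.
exact: (normal_form_derivation lieV coV lbrE (cent_symbol_in_R s2)
  (fun i => even_symbol_in_R i t0) (fun i => odd_symbol_in_Rt i t1) L
  (loop_act_normal t0 t1 t2)).
Qed.

Theorem loop_derivation_decomp D : derivation lbr D ->
  exists s0 s1 s2,
    [/\ tensor_sum (Der false) R s0, tensor_sum (Der true) Rt s1 &
        tensor_sum Cent (@Der_S F) s2] /\
    forall x, twval (D x) = loop_act s0 s1 s2 (twval x).
Proof.
move=> dD; have [f [g [b [fR gR bR DN]]]] :=
  derivation_normal_form lieV frV coV lbrE dD.
have /choice [delta dE] i : exists delta : evenLaurent F -> evenLaurent F,
  Der_S delta /\ twval (delta (lX2 F 1)) = f i by exact: Der_S_exists.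
(* Pairing the basis elements with the series of the normal form produces exactly the symbols [g],
   [b] and [f]. *)
pose s0 := [seq (even_basis i, g i) | i <- enum 'I_n].
pose s1 := [seq (odd_basis i, b i) | i <- enum 'I_n].
pose s2 := [seq (cent_basis i, delta i) | i <- enum 'I_n].
have t0 : tensor_sum (Der false) R s0.
  by move=> _ /mapP[i _ ->]; split=> //=; exact: even_basis_der.
have t1 : tensor_sum (Der true) Rt s1.
  by move=> _ /mapP[i _ ->]; split=> //=; exact: odd_basis_der.
have t2 : tensor_sum Cent (@Der_S F) s2.
  by move=> _ /mapP[i _ ->]; split; [exact: cent_basis_cent | case: (dE i)].
have sumE (r : 'I_n -> laurent F^o) i (a : 'I_n -> F) : (forall j, a j = (j == i)%:R) ->
    \sum_(j <- enum 'I_n) a j *: r j = r i.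
  move=> aE; rewrite big_enum (bigD1 i) //= big1 => [|j ji].
    by rewrite aE eqxx scale1r addr0.
  by rewrite aE (negPf ji) scale0r.
exists s0, s1, s2; split=> // x; move: x.
apply: (normal_form_eq coV _ _ DN).
- by move=> c u v; rewrite /= (proj1 dD) twvalD twvalZ.
- by move=> c u v; rewrite twvalD twvalZ; exact: loop_act_linear.
have := loop_act_normal t0 t1 t2.
have -> : even_symbol s0 = g.
  apply/funext => i; rewrite /even_symbol big_map; apply: sumE => j.
  rewrite even_basisE linearZ /= !(eta_e frV coV).
  by have [_|_] := eqVneq j i; [exact: mulr1 | exact: mulr0].
have -> : odd_symbol s1 = b.
  apply/funext => i; rewrite /odd_symbol big_map; apply: sumE => j.
  rewrite odd_basisE linearZ /= (eta_e frV coV) (xi_h frV coV).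
  by have [_|_] := eqVneq j i; [exact: mulr1 | exact: mulr0].
have -> // : cent_symbol s2 = f.
apply/funext => i; rewrite /cent_symbol big_map /=.
rewrite (eq_bigr (fun j => (xi i (cent_basis j (h i)) : F) *: f j)); last first.
  by move=> j _; rewrite (proj2 (dE j)).
apply: sumE => j; rewrite cent_basisE linearD !linearZ /= !(xi_h frV coV).
rewrite (xi_e frV coV).
by rewrite scaler0 addr0; have [_|_] := eqVneq j i; [exact: mulr1 | exact: mulr0].
Qed.

End LoopAct.

(** * Passage to the subalgebra and conclusion *)

Lemma sub_br_lie (F : fieldType) (V : vectType F) (br : V -> V -> V) (L : {vspace V}) :
  lie_bracket br -> subalgebra br L -> lie_bracket (sub_br br (U := L)).
Proof.
move=> lieV algL.
have vsvalL c (u v : subvs_of L) : vsval (c *: u + v) = c *: vsval u + vsval v.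
  exact: linearP.
have vsvalD (u v : subvs_of L) : vsval (u + v) = vsval u + vsval v by exact: linearD.
split=> [y c u v | x c u v | x | x y z]; apply: subvs_inj; cbv beta.
- by rewrite vsvalL !sub_brE // vsvalL (lie_linearl lieV).
- by rewrite vsvalL !sub_brE // vsvalL (lie_linearr lieV).
- by rewrite sub_brE // (lie_alternating lieV) linear0.
by rewrite !vsvalD !sub_brE // (lie_jacobi lieV) linear0.
Qed.

(** The first two clauses say that the action of formal sums has all derivations, and only those, as
    values. The third makes it well defined and injective on the direct sum of the tensor
    products. *)
Theorem theorem3p6 (F : closedFieldType) (LL : vectType F)
    (br : LL -> LL -> LL) (H L : {vspace LL}) :
  [pchar F] =i pred0 ->
  lie_bracket br ->
  semisimple br ->
  maximal_torus br H ->
  minimal_Q_graded br H L ->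
  \dim L = (2 * \dim (lie_comm br L L))%N ->
  let brL : subvs_of L -> subvs_of L -> subvs_of L := sub_br br (U := L) in
  let H_L : {vspace subvs_of L} := subv_in L H in
  let I_L : {vspace subvs_of L} := subv_in L (lie_comm br L L) in
  let Der_L (k : bool) (d : 'End(subvs_of L)) : Prop :=
    graded_derivation brL (lie_gr H_L I_L) k d in
  let Cent_L (lam : 'End(subvs_of L)) : Prop := centroid brL lam in
  let R (r : laurent F^o) : Prop := r \in in_R in
  let Rt (r : laurent F^o) : Prop := r \in in_Rt in
  let DerS : (evenLaurent F -> evenLaurent F) -> Prop := @Der_S F in
  let in_summands s0 s1 s2 : Prop :=
    [/\ tensor_sum (Der_L false) R s0,
        tensor_sum (Der_L true) Rt s1 &
        tensor_sum Cent_L DerS s2] in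
  let Lbar : Type := twloop H_L I_L in
  let brLbar : Lbar -> Lbar -> Lbar := loop_br brL in
  [/\ forall s0 s1 s2, in_summands s0 s1 s2 ->
        exists D : Lbar -> Lbar, derivation brLbar D /\
          forall x, twval (D x) = loop_act s0 s1 s2 (twval x),
      forall D : Lbar -> Lbar, derivation brLbar D ->
        exists s0 s1 s2, in_summands s0 s1 s2 /\
          forall x, twval (D x) = loop_act s0 s1 s2 (twval x),
      forall s0 s1 s2, in_summands s0 s1 s2 ->
        (forall x : Lbar, loop_act s0 s1 s2 (twval x) = 0) <->
        [/\ tensor_zero (Der_L false) R s0,
            tensor_zero (Der_L true) Rt s1 &
            tensor_zero Cent_L DerS s2] &
      forall D : Lbar -> Lbar,
        homogeneous_derivation brLbar (loop_gr H_L I_L) D ->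
        almost_inner brLbar D -> inner brLbar D].
Proof.
move=> char0 lieL ssL [torH _] [[algL HL [Psi [_ rootPsi spanPsi dirL defL]]] _] dimL.
move=> brL H_L I_L Der_L Cent_L R Rt DerS in_summands Lbar brLbar.
have [h [e frL]] :=
  Q_graded_frame char0 lieL ssL torH algL HL rootPsi spanPsi dirL defL dimL.
have lie_L := sub_br_lie lieL algL.
have [xi [eta coL]] := frame_coords_exist lie_L frL.
split.
- by move=> s0 s1 s2 [t0 t1 t2]; exact: (loop_derivations lie_L frL coL).
- by move=> D /(loop_derivation_decomp lie_L frL coL).
- move=> s0 s1 s2 [t0 t1 t2].
  apply: (iff_trans (loop_act_eq0 lie_L frL coL t0 t1 t2)).
  split=> -[z0 z1 z2]; split.
  + exact: (proj2 (even_tensor_zero lie_L frL coL t0)).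
  + exact: (proj2 (odd_tensor_zero lie_L frL coL t1)).
  + exact: (proj2 (cent_tensor_zero lie_L frL coL t2)).
  + exact: (proj1 (even_tensor_zero lie_L frL coL t0)).
  + exact: (proj1 (odd_tensor_zero lie_L frL coL t1)).
  + exact: (proj1 (cent_tensor_zero lie_L frL coL t2)).
move=> D _; apply: (almost_inner_inner lie_L frL coL).
by move=> x y; apply: (twval_loop_br lie_L frL coL).
Qed.
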